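(* Given a finite data-graph $G$, a set $R$ of Reg-GXPath$^{pos}$ expressions (node and/or path expressions), and a preference criterion $\mathrm{Pref}$, which is either weight-based preference (for a fixed weight function $w:\Sigma_e\sqcup\Sigma_n\to\mathbb{N}$ computable in polynomial time) or multiset-based preference (for a fixed well-founded strict partial order $<$ on $\Sigma_e\sqcup\Sigma_n$ decidable in polynomial time), there exists an algorithm that computes the $\mathrm{Pref}$-preferred $\subseteq$-repair of $G$ with respect to $R$.
   Context: **Data-graphs.** Fix a finite set $\Sigma_e$ of edge labels and a countable set $\Sigma_n$ of data values, both non-empty, with $\Sigma_e\cap\Sigma_n=\emptyset$. A data-graph is a tuple $G=(V,L,D)$ with $V$ a set of nodes (possibly empty), $L:V\times V\to\mathcal{P}(\Sigma_e)$ and $D:V\to\Sigma_n$. **Reg-GXPath$^{pos}$.** Node expressions $\varphi,\psi$ and path expressions $\alpha,\beta$ are given by mutual recursion ($c\in\Sigma_n$, $a\in\Sigma_e$): $\varphi,\psi ::= c^{=}\mid c^{\neq}\mid \varphi\vee\psi\mid\varphi\wedge\psi\mid\langle\alpha\rangle\mid\langle\alpha=\beta\rangle\mid\langle\alpha\neq\beta\rangle$; $\alpha,\beta ::= \epsilon\mid \_\mid a\mid a^-\mid\alpha\circ\beta\mid\alpha\cup\beta\mid\alpha\cap\beta\mid\alpha^*\mid[\varphi]\mid\alpha^{n,m}$. (Full Reg-GXPath additionally allows the negation $\neg\varphi$ and the path complement $\overline{\alpha}$; these are excluded here.) A Reg-GXPath$^{pos}$ expression is a node expression or a path expression of this grammar.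 Semantics on $G=(V,L,D)$, where $[\![\alpha]\!]_G\subseteq V\times V$ and $[\![\varphi]\!]_G\subseteq V$: $[\![\epsilon]\!]=\{(v,v):v\in V\}$; $[\![\_]\!]=\{(v,w):L(v,w)\neq\emptyset\}$; $[\![a]\!]=\{(v,w):a\in L(v,w)\}$; $[\![a^-]\!]=\{(w,v):a\in L(v,w)\}$; $\circ,\cup,\cap$ are relation composition, union, intersection; $[\![\alpha^*]\!]$ is the reflexive transitive closure of $[\![\alpha]\!]$; $[\![\alpha^{n,m}]\!]$ is the union of the $k$-fold compositions of $[\![\alpha]\!]$ for $n\le k\le m$; $[\![[\varphi]]\!]=\{(v,v):v\in[\![\varphi]\!]\}$; $[\![c^=]\!]=\{v:D(v)=c\}$; $[\![c^{\neq}]\!]=\{v:D(v)\neq c\}$; $\wedge,\vee$ are intersection and union; $[\![\langle\alpha\rangle]\!]=\{v:\exists w,(v,w)\in[\![\alpha]\!]\}$; $[\![\langle\alpha=\beta\rangle]\!]$ (resp. $[\![\langle\alpha\neq\beta\rangle]\!]$) is the set of $v$ for which there are $u,w$ with $(v,u)\in[\![\alpha]\!]$, $(v,w)\in[\![\beta]\!]$ and $D(u)=D(w)$ (resp. $D(u)\ne D(w)$). **Consistency.** For a set $R$ of node and path expressions, $G\models R$ if $[\![\varphi]\!]_G=V$ for every node expression $\varphi\in R$ and $[\![\alpha]\!]_G=V\times V$ for every path expression $\alpha\in R$. **Subset repairs.** $(V,L,D)\subseteq(V',L',D')$ iff $V\subseteq V'$ and, for all $v,v'\in V$, $L(v,v')\subseteq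 L'(v,v')$ and $D(v)=D'(v)$. $G'$ is a $\subseteq$-repair of $G$ with respect to $R$ if $G'\models R$, $G'\subseteq G$, and there is no $G''\models R$ with $G'\subset G''\subseteq G$. **Preferences.** Weight-based: $w$ extends to finite data-graphs by $w(G)=\sum_{x,y\in V}\sum_{z\in L(x,y)}w(z)+\sum_{x\in V}w(D(x))$; for subset repairs, $G_2$ is preferred to $G_1$ if $w(G_1)<w(G_2)$. Multiset-based: for a finite data-graph $G$, let $M_G:\Sigma_e\sqcup\Sigma_n\to\mathbb{N}$ be $M_G(x)=|[\![x]\!]_G|$ for $x\in\Sigma_e$ and $M_G(x)=|[\![x^=]\!]_G|$ for $x\in\Sigma_n$. For finite multisets, $M_1<_{mset}M_2$ iff $M_1\neq M_2$ and for every $x$ with $M_1(x)>M_2(x)$ there is $y$ with $x<y$ and $M_1(y)<M_2(y)$. For subset repairs, $G_2$ is preferred to $G_1$ if $M_{G_1}<_{mset}M_{G_2}$. A $\subseteq$-repair of $G$ is $\mathrm{Pref}$-preferred if no other $\subseteq$-repair of $G$ is preferred to it. *)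

(* Defs.v *)
From Stdlib Require List.
From mathcomp Require Import all_boot finmap.
Set Implicit Arguments.
Unset Strict Implicit.
Unset Printing Implicit Defensive.

Local Open Scope fset_scope.

(** The model of computation is the WHILE language of N. D. Jones
    (_Computability and Complexity from a Programming Perspective_): imperative
    programs whose variables hold binary trees. It is Turing complete, and its
    polynomial-time computable functions on (encodings of) strings are those of
    Turing machines. There is deliberately no unit-cost equality test on trees;
    the only test is "is this a leaf", as the guard of a loop. *)

Inductive tree : Type := Leaf | Pair (l r : tree).

Fixpoint tsize (t : tree) : nat :=
  if t is Pair l r then (tsize l + tsize r).+1 else 1.

Definition thd (t : tree) : tree := if t is Pair l _ then l else Leaf.
Definition ttl (t : tree) : tree := if t is Pair _ r then r else Leaf.

Inductive texpr : Type :=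
  | EVar (x : nat)
  | ELeaf
  | EPair (e1 e2 : texpr)
  | EHd (e : texpr)
  | ETl (e : texpr).

Inductive cmd : Type :=
  | Assign (x : nat) (e : texpr)
  | Seq (c1 c2 : cmd)
  | While (e : texpr) (c : cmd).

Definition store : Type := nat -> tree.

Definition upd (s : store) (x : nat) (t : tree) : store :=
  fun y => if y == x then t else s y.

Fixpoint eval (s : store) (e : texpr) : tree :=
  match e with
  | EVar x => s x
  | ELeaf => Leaf
  | EPair e1 e2 => Pair (eval s e1) (eval s e2)
  | EHd e1 => thd (eval s e1)
  | ETl e1 => ttl (eval s e1)
  end.

(** [exec c s s' n]: started in [s], [c] halts in [s'] after [n] assignments and
    loop tests. Charging one unit whatever the size of the expression changes the
    time by a factor that depends on the program only. *)
Inductive exec : cmd -> store -> store -> nat -> Prop :=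
  | exec_assign x e s : exec (Assign x e) s (upd s x (eval s e)) 1
  | exec_seq c1 c2 s s1 s2 n1 n2 :
      exec c1 s s1 n1 -> exec c2 s1 s2 n2 -> exec (Seq c1 c2) s s2 (n1 + n2)
  | exec_while_stop e c s : eval s e = Leaf -> exec (While e c) s s 1
  | exec_while_step e c s s1 s2 n1 n2 :
      eval s e <> Leaf -> exec c s s1 n1 -> exec (While e c) s1 s2 n2 ->
      exec (While e c) s s2 (n1 + n2).+1.

(** Variable 0 holds the input, and the output on halting; all other variables
    are initially [Leaf]. *)
Definition runs_in (c : cmd) (input output : tree) (n : nat) : Prop :=
  exists s, exec c (upd (fun=> Leaf) 0 input) s n /\ s 0 = output.

Definition outputs (c : cmd) (input output : tree) : Prop :=
  exists n, runs_in c input output n.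

Definition polytime (A B : Type) (encA : A -> tree) (encB : B -> tree)
    (f : A -> B) : Prop :=
  exists (c : cmd) (a k : nat), forall x : A,
    exists2 n, runs_in c (encA x) (encB (f x)) n & n <= a * tsize (encA x) ^ k.

Definition enc_bool (b : bool) : tree := if b then Pair Leaf Leaf else Leaf.

Definition enc_seq (A : Type) (enc : A -> tree) (s : seq A) : tree :=
  foldr (fun x t => Pair (enc x) t) Leaf s.

Definition enc_pair (A B : Type) (encA : A -> tree) (encB : B -> tree)
    (p : A * B) : tree := Pair (encA p.1) (encB p.2).

Definition enc_sum (A B : Type) (encA : A -> tree) (encB : B -> tree)
    (u : A + B) : tree :=
  match u with
  | inl x => Pair (enc_bool false) (encA x)
  | inr y => Pair (enc_bool true) (encB y)
  end.

(** Binary, least significant digit first. *)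
Fixpoint pos_bits (p : BinNums.positive) : seq bool :=
  match p with
  | BinNums.xH => [:: true]
  | BinNums.xO q => false :: pos_bits q
  | BinNums.xI q => true :: pos_bits q
  end.

Definition bits (n : nat) : seq bool :=
  if bin_of_nat n is BinNums.Npos p then pos_bits p else [::].

Definition enc_nat (n : nat) : tree := enc_seq enc_bool (bits n).

(** Elements of a countable type are given by the binary notation of their index.
    The enumeration [pickle] is part of the [countType] structure, so quantifying
    over [T : countType] quantifies over all encodings of [T]. *)
Definition enc_count (T : countType) (x : T) : tree := enc_nat (choice.pickle x).

(** Finite data-graphs, with nodes in a universe [N]. A subgraph of a finite
    data-graph is finite, so infinite ones never occur below. *)
Record data_graph (Se : finType) (Sn N : countType) := DataGraph {
  nodes : {fset N};
  labels : {ffun nodes * nodes -> {set Se}};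
  data : {ffun nodes -> Sn} }.

Definition subgraph (Se : finType) (Sn N : countType)
    (G1 G2 : data_graph Se Sn N) : Prop :=
  exists sub : nodes G1 `<=` nodes G2, forall v v' : nodes G1,
    labels G1 (v, v') \subset labels G2 (fincl sub v, fincl sub v') /\
    data G1 v = data G2 (fincl sub v).

Definition proper_subgraph (Se : finType) (Sn N : countType)
    (G1 G2 : data_graph Se Sn N) : Prop := subgraph G1 G2 /\ G1 <> G2.

(** A data-graph is presented to a program by the list of its nodes with their
    data values and the list of its labelled edges, without repetition and in any
    order. The order is left free because the canonical enumeration of an
    [{fset N}] need not be computable. *)
Definition represents (Se : finType) (Sn N : countType)
    (t : tree) (G : data_graph Se Sn N) : Prop :=
  exists (ns : seq (N * Sn)) (es : seq (N * Se * N)),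
    [/\ perm_eq ns [seq (val x, data G x) | x : nodes G],
        perm_eq es [seq (val p.1.1, p.2, val p.1.2)
          | p : (nodes G * nodes G * Se)%type in [pred p | p.2 \in labels G p.1]]
      & t = Pair
          (enc_seq (enc_pair (@enc_count N) (@enc_count Sn)) ns)
          (enc_seq (enc_pair (enc_pair (@enc_count N) (@enc_count Se))
                             (@enc_count N)) es)].

Inductive node_expr (Se Sn : Type) : Type :=
  | NEq (c : Sn)
  | NNeq (c : Sn)
  | NOr (phi psi : node_expr Se Sn)
  | NAnd (phi psi : node_expr Se Sn)
  | NEx (alpha : path_expr Se Sn)
  | NExEq (alpha beta : path_expr Se Sn)
  | NExNeq (alpha beta : path_expr Se Sn)
with path_expr (Se Sn : Type) : Type :=
  | PEps
  | PAny
  | PLab (a : Se)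
  | PInv (a : Se)
  | PComp (alpha beta : path_expr Se Sn)
  | PUnion (alpha beta : path_expr Se Sn)
  | PInter (alpha beta : path_expr Se Sn)
  | PStar (alpha : path_expr Se Sn)
  | PTest (phi : node_expr Se Sn)
  | PIter (alpha : path_expr Se Sn) (n m : nat).

Arguments PEps {Se Sn}.
Arguments PAny {Se Sn}.

Definition rcomp (T : finType) (A B : {set T * T}) : {set T * T} :=
  [set p | [exists u, ((p.1, u) \in A) && ((u, p.2) \in B)]].

Definition rdiag (T : finType) (A : {set T}) : {set T * T} :=
  [set p | (p.1 \in A) && (p.1 == p.2)].

Definition rpow (T : finType) (A : {set T * T}) (k : nat) : {set T * T} :=
  iter k (rcomp A) (rdiag [set: T]).

(** [connect] is the reflexive transitive closure. *)
Definition rstar (T : finType) (A : {set T * T}) : {set T * T} :=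
  [set p | connect (fun x y => (x, y) \in A) p.1 p.2].

Fixpoint node_sem (Se : finType) (Sn N : countType) (G : data_graph Se Sn N)
    (phi : node_expr Se Sn) : {set nodes G} :=
  match phi with
  | NEq c => [set v | data G v == c]
  | NNeq c => [set v | data G v != c]
  | NOr phi1 phi2 => node_sem G phi1 :|: node_sem G phi2
  | NAnd phi1 phi2 => node_sem G phi1 :&: node_sem G phi2
  | NEx alpha => [set v | [exists w, (v, w) \in path_sem G alpha]]
  | NExEq alpha beta =>
      [set v | [exists u, exists w, [&& (v, u) \in path_sem G alpha,
         (v, w) \in path_sem G beta & data G u == data G w]]]
  | NExNeq alpha beta =>
      [set v | [exists u, exists w, [&& (v, u) \in path_sem G alpha,
         (v, w) \in path_sem G beta & data G u != data G w]]]
  end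
with path_sem (Se : finType) (Sn N : countType) (G : data_graph Se Sn N)
    (alpha : path_expr Se Sn) : {set nodes G * nodes G} :=
  match alpha with
  | PEps => rdiag [set: nodes G]
  | PAny => [set p | labels G p != set0]
  | PLab a => [set p | a \in labels G p]
  | PInv a => [set p | a \in labels G (p.2, p.1)]
  | PComp beta gamma => rcomp (path_sem G beta) (path_sem G gamma)
  | PUnion beta gamma => path_sem G beta :|: path_sem G gamma
  | PInter beta gamma => path_sem G beta :&: path_sem G gamma
  | PStar beta => rstar (path_sem G beta)
  | PTest phi => rdiag (node_sem G phi)
  | PIter beta n m => \bigcup_(n <= k < m.+1) rpow (path_sem G beta) k
  end.

Definition gx_expr (Se Sn : Type) : Type := (node_expr Se Sn + path_expr Se Sn)%type.

(** [R] lists a finite set of constraints; order and repetitions are irrelevant. *)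
Definition models (Se : finType) (Sn N : countType) (G : data_graph Se Sn N)
    (R : seq (gx_expr Se Sn)) : Prop :=
  (forall phi, List.In (inl phi) R -> node_sem G phi = [set: nodes G]) /\
  (forall alpha, List.In (inr alpha) R ->
     path_sem G alpha = [set: nodes G * nodes G]).

Definition tagged_tree (k : nat) (t : tree) : tree := Pair (enc_nat k) t.

Fixpoint enc_node_expr (Se Sn : countType) (phi : node_expr Se Sn) : tree :=
  match phi with
  | NEq c => tagged_tree 0 (enc_count c)
  | NNeq c => tagged_tree 1 (enc_count c)
  | NOr phi1 phi2 => tagged_tree 2 (Pair (enc_node_expr phi1) (enc_node_expr phi2))
  | NAnd phi1 phi2 => tagged_tree 3 (Pair (enc_node_expr phi1) (enc_node_expr phi2))
  | NEx alpha => tagged_tree 4 (enc_path_expr alpha)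
  | NExEq alpha beta => tagged_tree 5 (Pair (enc_path_expr alpha) (enc_path_expr beta))
  | NExNeq alpha beta => tagged_tree 6 (Pair (enc_path_expr alpha) (enc_path_expr beta))
  end
with enc_path_expr (Se Sn : countType) (alpha : path_expr Se Sn) : tree :=
  match alpha with
  | PEps => tagged_tree 0 Leaf
  | PAny => tagged_tree 1 Leaf
  | PLab a => tagged_tree 2 (enc_count a)
  | PInv a => tagged_tree 3 (enc_count a)
  | PComp beta gamma => tagged_tree 4 (Pair (enc_path_expr beta) (enc_path_expr gamma))
  | PUnion beta gamma => tagged_tree 5 (Pair (enc_path_expr beta) (enc_path_expr gamma))
  | PInter beta gamma => tagged_tree 6 (Pair (enc_path_expr beta) (enc_path_expr gamma))
  | PStar beta => tagged_tree 7 (enc_path_expr beta)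
  | PTest phi => tagged_tree 8 (enc_node_expr phi)
  | PIter beta n m =>
      tagged_tree 9 (Pair (enc_path_expr beta) (Pair (enc_nat n) (enc_nat m)))
  end.

Definition enc_constraints (Se Sn : countType) : seq (gx_expr Se Sn) -> tree :=
  enc_seq (enc_sum (@enc_node_expr Se Sn) (@enc_path_expr Se Sn)).

Definition subset_repair (Se : finType) (Sn N : countType)
    (R : seq (gx_expr Se Sn)) (G G' : data_graph Se Sn N) : Prop :=
  [/\ models G' R, subgraph G' G &
      ~ exists G'', [/\ models G'' R, proper_subgraph G' G'' & subgraph G'' G]].

Definition graph_weight (Se : finType) (Sn N : countType)
    (w : Se + Sn -> nat) (G : data_graph Se Sn N) : nat :=
  \sum_(x : nodes G) \sum_(y : nodes G) \sum_(z in labels G (x, y)) w (inl z)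
  + \sum_(x : nodes G) w (inr (data G x)).

Definition graph_mset (Se : finType) (Sn N : countType)
    (G : data_graph Se Sn N) (x : Se + Sn) : nat :=
  match x with
  | inl a => #|path_sem G (PLab Sn a)|
  | inr c => #|node_sem G (NEq Se c)|
  end.

Definition mset_lt (T : Type) (lt : rel T) (M1 M2 : T -> nat) : Prop :=
  ~ (M1 =1 M2) /\
  forall x, M2 x < M1 x -> exists y, lt x y /\ M1 y < M2 y.

Inductive preference (Se Sn : Type) : Type :=
  | WeightPref (w : Se + Sn -> nat)
  | MsetPref (lt : rel (Se + Sn)%type).

Definition enc_sym (Se Sn : countType) : Se + Sn -> tree :=
  enc_sum (@enc_count Se) (@enc_count Sn).

Definition admissible (Se Sn : countType) (Pref : preference Se Sn) : Prop :=
  match Pref with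
  | WeightPref w => polytime (@enc_sym Se Sn) enc_nat w
  | MsetPref lt =>
      [/\ irreflexive lt, transitive lt, well_founded (fun x y => lt x y)
        & polytime (enc_pair (@enc_sym Se Sn) (@enc_sym Se Sn)) enc_bool
                   (fun p => lt p.1 p.2)]
  end.

(** [preferred_to Pref G1 G2]: [G2] is preferred to [G1]. *)
Definition preferred_to (Se : finType) (Sn N : countType)
    (Pref : preference Se Sn) (G1 G2 : data_graph Se Sn N) : Prop :=
  match Pref with
  | WeightPref w => graph_weight w G1 < graph_weight w G2
  | MsetPref lt => mset_lt lt (graph_mset G1) (graph_mset G2)
  end.

Definition preferred_repair (Se : finType) (Sn N : countType)
    (Pref : preference Se Sn) (R : seq (gx_expr Se Sn))
    (G G' : data_graph Se Sn N) : Prop :=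
  subset_repair R G G' /\
  ~ exists G'', [/\ subset_repair R G G'', G'' <> G' & preferred_to Pref G' G''].

(* Main.v *)
(** No time bound is imposed, so exhaustive search is enough. A finite data-graph has
    finitely many subgraphs; keep those that satisfy [R], then those maximal for
    inclusion, then those maximal for the preference. The empty graph satisfies every
    set of positive expressions, and both inclusion and preference are strict partial
    orders, so that no stage of this selection is empty.

    That this search can be programmed follows from closure properties: the functions
    computed on encodings by some WHILE program are closed under composition, pairing,
    conditionals and terminating loops, hence under folds over lists. An expression is
    evaluated on a stack, along the postorder list of its subexpressions. *)

Require Import Defs.
From HB Require Import structures.
From mathcomp Require Import all_boot finmap zify.

Set Implicit Arguments.
Unset Strict Implicit.
Unset Printing Implicit Defensive.

(** * WHILE programs *)

(** Node names, labels and data values reach a program only as opaque trees. All that is done with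
    them is to copy them, to compare their encodings for equality, which is sound because encodings
    are injective, and to hand them to the program for the weight or the order. The functions are
    therefore written on lists of values ([lgraph], [lrel]), shown computable through the encodings,
    and compared with the set semantics by [lrep] and [prep], which do not mention the order of the
    lists. The repair that is returned may depend on the order of the input; only its being
    preferred is claimed. Expressions, in contrast, stay encoded ([code]): WHILE programs have no
    recursion, so the evaluator reads the tags of the trees itself. Numbers are unary inside the
    programs, since a unary number is a list of units and iteration becomes a fold; binary numbers
    are decoded where they enter. *)

Fixpoint expr_bound (e : texpr) : nat :=
  match e with
  | EVar x => x.+1
  | ELeaf => 0
  | EPair e1 e2 => maxn (expr_bound e1) (expr_bound e2)
  | EHd e | ETl e => expr_bound e
  end.

Fixpoint cmd_bound (c : cmd) : nat :=
  match c with
  | Assign x e => maxn x.+1 (expr_bound e)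
  | Seq c1 c2 => maxn (cmd_bound c1) (cmd_bound c2)
  | While e c => maxn (expr_bound e) (cmd_bound c)
  end.

Lemma eval_agree K e (s1 s2 : store) : expr_bound e <= K ->
  (forall i, i < K -> s1 i = s2 i) -> eval s1 e = eval s2 e.
Proof.
move=> + eq12; elim: e => //=.
- by move=> e1 IH1 e2 IH2; rewrite geq_max => /andP[/IH1-> /IH2->].
- by move=> e IH /IH->.
- by move=> e IH /IH->.
Qed.

(** Variables from [K] on form a frame that a program below [K] neither reads nor writes. In a
    language without procedures this is what allows data to be kept while another program runs. *)
Lemma exec_frame K c s1 s1' n : exec c s1 s1' n -> cmd_bound c <= K ->
  forall s2 : store, (forall i, i < K -> s1 i = s2 i) ->
  exists s2', [/\ exec c s2 s2' n, forall i, i < K -> s1' i = s2' i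
                & forall i, K <= i -> s2' i = s2 i].
Proof.
elim=> {c s1 s1' n} /=.
- move=> x e s; rewrite geq_max => /andP[ltxK leeK] s2 eq12.
  exists (upd s2 x (eval s2 e)); split; first exact: exec_assign.
    by move=> i ltiK; rewrite /upd (eval_agree leeK eq12) eq12.
  by move=> i leKi; rewrite /upd gtn_eqF //; apply: leq_trans leKi.
- move=> c1 c2 s s1 s2 n1 n2 _ IH1 _ IH2; rewrite geq_max => /andP[le1 le2] t eqt.
  have [t1 [ex1 eqt1 fr1]] := IH1 le1 _ eqt.
  have [t2 [ex2 eqt2 fr2]] := IH2 le2 _ eqt1.
  exists t2; split=> //; first exact: exec_seq ex1 ex2.
  by move=> i leKi; rewrite fr2 ?fr1.
- move=> e c s es; rewrite geq_max => /andP[le1 le2] t eqt.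
  exists t; split=> //; apply: exec_while_stop.
  by rewrite -(eval_agree le1 eqt).
- move=> e c s s1 s2 n1 n2 es _ IH1 _ IH2 lewK t eqt.
  move: (lewK); rewrite geq_max => /andP[le1 le2].
  have [t1 [ex1 eqt1 fr1]] := IH1 le2 _ eqt.
  have [t2 [ex2 eqt2 fr2]] := IH2 lewK _ eqt1.
  exists t2; split=> //; last by move=> i leKi; rewrite fr2 ?fr1.
  by apply: exec_while_step ex1 ex2; rewrite -(eval_agree le1 eqt).
Qed.

Definition run (c : cmd) (s s' : store) : Prop := exists n, exec c s s' n.

Lemma run_assign x e s : run (Assign x e) s (upd s x (eval s e)).
Proof. by exists 1; apply: exec_assign. Qed.

Lemma run_seq c1 c2 s s1 s2 : run c1 s s1 -> run c2 s1 s2 -> run (Seq c1 c2) s s2.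
Proof. by move=> [n1 ?] [n2 ?]; exists (n1 + n2); apply: exec_seq; eassumption. Qed.

Lemma run_while_stop e c s : eval s e = Leaf -> run (While e c) s s.
Proof. by exists 1; apply: exec_while_stop. Qed.

Lemma run_while_step e c s s1 s2 : eval s e <> Leaf -> run c s s1 ->
  run (While e c) s1 s2 -> run (While e c) s s2.
Proof.
by move=> ? [n1 ?] [n2 ?]; exists (n1 + n2).+1; apply: exec_while_step; eassumption.
Qed.

(** There is no skip command; the base case resets variable 0 instead, whence the condition [0 < i]
    in [run_clear]. *)
Fixpoint clear (K : nat) : cmd :=
  if K is k.+1 then Seq (Assign k ELeaf) (clear k) else Assign 0 ELeaf.

Lemma run_clear K s : exists s', [/\ run (clear K) s s', s' 0 = Leaf,
  forall i, i < K -> s' i = Leaf & forall i, 0 < i -> K <= i -> s' i = s i].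
Proof.
elim: K s => [|K IH] s /=.
  exists (upd s 0 Leaf); split=> //; first exact: run_assign.
  by move=> [].
have [s' [rs s0 sL sF]] := IH (upd s K Leaf).
exists s'; split=> //.
- by apply: run_seq rs; apply: (run_assign K ELeaf).
- move=> i; rewrite ltnS leq_eqVlt => /orP[/eqP->|/sL //].
  by case: (posnP K) => [->//|K0]; rewrite sF // /upd eqxx.
- by move=> i i0 ltKi; rewrite sF ?(ltnW ltKi) // /upd gtn_eqF.
Qed.

(* Runs [c], whose variables are below [K], on the content of variable [j], from a
   clean store below [K] and without touching the variables from [K] on. *)
Definition call (c : cmd) (K j : nat) : cmd :=
  Seq (clear K) (Seq (Assign 0 (EVar j)) c).

Lemma run_call c K j s x y : cmd_bound c < K -> K <= j -> s j = x ->
  outputs c x y ->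
  exists s', [/\ run (call c K j) s s', s' 0 = y & forall i, K <= i -> s' i = s i].
Proof.
move=> ltcK leKj sj [n [s1 [ex out]]].
have K0 : 0 < K by apply: leq_ltn_trans ltcK.
have [s2 [r2 _ s2L s2F]] := run_clear K s.
set s3 := upd s2 0 (eval s2 (EVar j)).
(* The given run starts from a store that is [Leaf] everywhere but at 0; the actual store agrees
   with it below [K] only, which is enough. *)
have [|s4 [ex4 eq4 fr4]] := exec_frame ex (ltnW ltcK) (s2 := s3).
  move=> i ltiK; rewrite /s3 /upd; case: eqP => // _ /=.
    by rewrite s2F ?(leq_trans K0).
  by rewrite s2L.
exists s4; split.
- apply: run_seq r2 _; apply: run_seq (run_assign _ _ _) _.
  by exists n.
- by rewrite -eq4.
- move=> i leKi; have i0 := leq_trans K0 leKi.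
  by rewrite fr4 // /s3 /upd gtn_eqF // s2F.
Qed.

Lemma outputs_run c x y s : run c (upd (fun=> Leaf) 0 x) s -> s 0 = y ->
  outputs c x y.
Proof. by move=> [n ex] s0; exists n, s. Qed.

(** Input and output are both indexed by [d], so that intermediate trees need not be encodings of
    values of some type. The domain [P] lets a branch or a loop body be programmed only for the
    instances that reach it. *)
Definition computes (D : Type) (P : D -> Prop) (i o : D -> tree) : Prop :=
  exists c, forall d, P d -> outputs c (i d) (o d).

Lemma computes_expr D (P : D -> Prop) (i o : D -> tree) e :
  (forall d, P d -> eval (upd (fun=> Leaf) 0 (i d)) e = o d) -> computes P i o.
Proof.
move=> eq_o; exists (Assign 0 e) => d Pd.
by apply: outputs_run (run_assign _ _ _) _; rewrite {1}/upd eqxx eq_o.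
Qed.

Lemma computes_comp D (P : D -> Prop) (i o q : D -> tree) :
  computes P i o -> computes P o q -> computes P i q.
Proof.
move=> [c1 out1] [c2 out2]; pose K := (maxn (cmd_bound c1) (cmd_bound c2)).+1.
exists (Seq (Seq (Assign K (EVar 0)) (call c1 K K))
            (Seq (Assign K (EVar 0)) (call c2 K K))) => d Pd.
pose s0 := upd (fun=> Leaf) 0 (i d).
have [|||s1 [r1 e1 _]] := run_call (c := c1) (K := K) (j := K)
  (s := upd s0 K (eval s0 (EVar 0))) _ _ _ (out1 d Pd).
- by rewrite ltnS leq_maxl.
- by [].
- by rewrite /upd eqxx.
have [|||s2 [r2 e2 _]] := run_call (c := c2) (K := K) (j := K)
  (s := upd s1 K (eval s1 (EVar 0))) _ _ _ (out2 d Pd).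
- by rewrite ltnS leq_maxr.
- by [].
- by rewrite /upd eqxx.
apply: outputs_run e2.
by apply: run_seq (run_seq (run_assign _ _ _) r1) (run_seq (run_assign _ _ _) r2).
Qed.

Lemma computes_pair D (P : D -> Prop) (i o1 o2 : D -> tree) :
  computes P i o1 -> computes P i o2 -> computes P i (fun d => Pair (o1 d) (o2 d)).
Proof.
move=> [c1 out1] [c2 out2]; pose K := (maxn (cmd_bound c1) (cmd_bound c2)).+1.
exists (Seq (Seq (Assign K (EVar 0)) (call c1 K K))
       (Seq (Seq (Assign K.+1 (EVar 0)) (call c2 K K))
            (Assign 0 (EPair (EVar K.+1) (EVar 0))))) => d Pd.
pose s0 := upd (fun=> Leaf) 0 (i d).
have [|||s1 [r1 e1 f1]] := run_call (c := c1) (K := K) (j := K)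
  (s := upd s0 K (eval s0 (EVar 0))) _ _ _ (out1 d Pd).
- by rewrite ltnS leq_maxl.
- by [].
- by rewrite /upd eqxx.
have [|||s2 [r2 e2 f2]] := run_call (c := c2) (K := K) (j := K)
  (s := upd s1 K.+1 (eval s1 (EVar 0))) _ _ _ (out2 d Pd).
- by rewrite ltnS leq_maxr.
- by [].
- by rewrite /upd ltn_eqF // f1 // /upd eqxx.
apply: outputs_run.
  apply: run_seq (run_seq (run_assign _ _ _) r1) _.
  exact: run_seq (run_seq (run_assign _ _ _) r2) (run_assign _ _ _).
by rewrite /upd /= e2 f2 // /upd eqxx /= e1.
Qed.

(** The only test is a loop guard, so each branch is a loop whose body clears its own guard.
    Variables [K] to [K.+3] hold the input, the condition, the flag of the second branch and the
    result; the first branch also clears that flag. *)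
Lemma computes_if D (P : D -> Prop) (i h o : D -> tree) :
  computes P i h -> computes (fun d => P d /\ h d <> Leaf) i o ->
  computes (fun d => P d /\ h d = Leaf) i o -> computes P i o.
Proof.
move=> [c0 out0] [c1 out1] [c2 out2].
pose K := (maxn (cmd_bound c0) (maxn (cmd_bound c1) (cmd_bound c2))).+1.
pose tt := EPair ELeaf ELeaf.
exists (Seq (Seq (Assign K (EVar 0)) (call c0 K K))
       (Seq (Seq (Assign K.+1 (EVar 0)) (Assign K.+2 tt))
       (Seq (While (EVar K.+1) (Seq (call c1 K K)
              (Seq (Assign K.+3 (EVar 0))
              (Seq (Assign K.+1 ELeaf) (Assign K.+2 ELeaf)))))
       (Seq (While (EVar K.+2) (Seq (call c2 K K)
              (Seq (Assign K.+3 (EVar 0)) (Assign K.+2 ELeaf))))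
            (Assign 0 (EVar K.+3)))))) => d Pd.
pose s0 := upd (fun=> Leaf) 0 (i d).
have [|||s1 [r1 e1 f1]] := run_call (c := c0) (K := K) (j := K)
  (s := upd s0 K (eval s0 (EVar 0))) _ _ _ (out0 d Pd).
- by rewrite ltnS leq_maxl.
- by [].
- by rewrite /upd eqxx.
pose s2 := upd (upd s1 K.+1 (h d)) K.+2 (Pair Leaf Leaf).
have r2 : run (Seq (Assign K.+1 (EVar 0)) (Assign K.+2 tt)) s1 s2.
  by apply: run_seq (run_assign _ _ _) _; rewrite /= e1; apply: run_assign.
have s2K : s2 K = i d.
  by rewrite /s2 /upd !ltn_eqF // f1 // /upd eqxx.
have s2K1 : s2 K.+1 = h d by rewrite /s2 /upd ltn_eqF // eqxx.
have s2K2 : s2 K.+2 = Pair Leaf Leaf by rewrite /s2 /upd eqxx.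
suff [s3 [r3 e3]] : exists s3, run (Seq (While (EVar K.+1) (Seq (call c1 K K)
              (Seq (Assign K.+3 (EVar 0))
              (Seq (Assign K.+1 ELeaf) (Assign K.+2 ELeaf)))))
       (While (EVar K.+2) (Seq (call c2 K K)
              (Seq (Assign K.+3 (EVar 0)) (Assign K.+2 ELeaf))))) s2 s3 /\ s3 K.+3 =
                o d.
  case: r3 => n ex3; inversion ex3; subst.
  apply: (outputs_run (s := upd s3 0 (eval s3 (EVar K.+3))));
    last by rewrite /upd /= e3.
  apply: run_seq (run_seq (run_assign _ _ _) r1) _; apply: run_seq r2 _.
  apply: (run_seq (s1 := s4)); first by exists n1.
  by apply: run_seq (run_assign _ _ _); exists n2.
case hd : (h d) => [|l r].
  have [|||s3 [r3 e3 f3]] := run_call (c := c2) (K := K) (j := K) (s := s2)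
    _ _ _ (out2 d (conj Pd hd)) => //.
    by rewrite ltnS !leq_max leqnn !orbT.
  exists (upd (upd s3 K.+3 (o d)) K.+2 Leaf); split.
    apply: (run_seq (s1 := s2)).
      by apply: run_while_stop; rewrite /= s2K1.
    apply: run_while_step.
    - by rewrite /= s2K2.
    - apply: run_seq r3 _; apply: run_seq (run_assign _ _ _) _.
      by rewrite /= e3; apply: run_assign.
    - by apply: run_while_stop; rewrite /= /upd eqxx.
  by rewrite /upd gtn_eqF // eqxx.
have hn : h d <> Leaf by rewrite hd.
have [|||s3 [r3 e3 f3]] := run_call (c := c1) (K := K) (j := K) (s := s2)
  _ _ _ (out1 d (conj Pd hn)) => //.
  by rewrite ltnS !leq_max leqnn !orbT.
pose s4 := upd (upd (upd s3 K.+3 (o d)) K.+1 Leaf) K.+2 Leaf.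
exists s4; split; last by rewrite /s4 /upd gtn_eqF // gtn_eqF // eqxx.
apply: (run_seq (s1 := s4)); last by apply: run_while_stop; rewrite /= /s4 /upd eqxx.
apply: run_while_step.
- by rewrite /= s2K1.
- apply: run_seq r3 _; apply: run_seq (run_assign _ _ _) _.
  by rewrite /= e3; apply: run_seq (run_assign _ _ _) (run_assign _ _ _).
- by apply: run_while_stop; rewrite /= /s4 /upd ltn_eqF // eqxx.
Qed.

(* [m] only serves as fuel to define the iterate; it need not be computable. *)
Lemma computes_while (D : Type) (i h : D -> tree) (b : D -> bool) (f : D -> D)
    (m : D -> nat) :
  (forall d, ~~ b d -> m (f d) < m d) -> (forall d, b d <-> h d = Leaf) ->
  computes (fun=> True) i h -> computes (fun d => ~~ b d) i (i \o f) ->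
  computes (fun=> True) i (fun d => i (iter (m d) (fun d => if b d then d else f d) d)).
Proof.
move=> decr bh [c0 out0] [c1 out1].
pose K := (maxn (cmd_bound c0) (cmd_bound c1)).+1.
pose test := Seq (Assign K (EVar 0)) (call c0 K K).
pose loop := While (EVar 0) (Seq (call c1 K K) test).
exists (Seq test (Seq loop (Assign 0 (EVar K)))) => d _.
set g := fun d => _.
have iter_stop d' n : b d' -> iter n g d' = d'.
  by move=> bd; elim: n => //= n ->; rewrite /g bd.
have run_test s d' : s 0 = i d' ->
    exists s', [/\ run test s s', s' 0 = h d' & s' K = i d'].
  move=> sE; have [|||s1 [r1 e1 f1]] := run_call (c := c0) (K := K) (j := K)
    (s := upd s K (eval s (EVar 0))) _ _ _ (out0 d' I).
  - by rewrite ltnS leq_maxl.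
  - by [].
  - by rewrite /upd eqxx.
  exists s1; split=> //; first exact: run_seq (run_assign _ _ _) r1.
  by rewrite f1 // /upd eqxx.
have run_loop n d' s : m d' <= n -> s 0 = h d' -> s K = i d' ->
    exists s', run loop s s' /\ s' K = i (iter n g d').
  elim: n d' s => [|n IH] d' s le_m s0 sK; have [bd|nbd] := boolP (b d').
  - exists s; split=> //; apply: run_while_stop; rewrite /= s0.
    exact/bh.
  - by have := decr _ nbd; move: le_m; rewrite leqn0 => /eqP->.
  - exists s; rewrite iter_stop //; split=> //; apply: run_while_stop; rewrite /= s0.
    exact/bh.
  have [||s1 [r1 e1 f1]] := run_call (c := c1) (K := K) (j := K) (s := s)
    _ _ sK (out1 d' nbd) => //.
    by rewrite ltnS leq_maxr.
  have [s2 [r2 e2 k2]] := run_test _ _ e1.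
  have [|s3 [r3 k3]] := IH (f d') s2 _ e2 k2.
    by rewrite -ltnS (leq_trans (decr _ nbd)).
  exists s3; split; last by rewrite iterSr /g (negPf nbd).
  apply: run_while_step r3; last exact: run_seq r1 r2.
  by rewrite /= s0 => /bh; rewrite (negPf nbd).
have [//|s1 [r1 e1 k1]] := run_test (upd (fun=> Leaf) 0 (i d)) d _.
have [s2 [r2 k2]] := run_loop _ _ _ (leqnn (m d)) e1 k1.
apply: outputs_run (run_seq r1 (run_seq r2 (run_assign _ _ _))) _.
by rewrite /upd /= k2.
Qed.

(** * Computable functions *)

Class Enc (A : Type) := enc : A -> tree.

#[local] Hint Mode Enc ! : typeclass_instances.

Definition enc_unary (n : nat) : tree := iter n (Pair Leaf) Leaf.

#[local] Instance Enc_tree : Enc tree := id.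
#[local] Instance Enc_bool : Enc bool := enc_bool.
#[local] Instance Enc_unary : Enc nat := enc_unary.
#[local] Instance Enc_seq A (eA : Enc A) : Enc (seq A) := enc_seq eA.
#[local] Instance Enc_prod A B (eA : Enc A) (eB : Enc B) : Enc (A * B) :=
  enc_pair eA eB.
#[local] Instance Enc_sum A B (eA : Enc A) (eB : Enc B) : Enc (A + B) :=
  enc_sum eA eB.

Definition computable A B {eA : Enc A} {eB : Enc B} (f : A -> B) : Prop :=
  computes (fun=> True) enc (fun x => enc (f x)).

Lemma computes_dom D (P Q : D -> Prop) i o :
  (forall d, Q d -> P d) -> computes P i o -> computes Q i o.
Proof. by move=> QP [c out]; exists c => d /QP/out. Qed.

Lemma computes_reindex A B {eA : Enc A} {eB : Enc B} (f : A -> B) D (P : D -> Prop)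
    (i o : D -> tree) : computable f ->
  (forall d, P d -> exists2 a, i d = enc a & o d = enc (f a)) -> computes P i o.
Proof. by move=> [c out] ex; exists c => d /ex[a -> ->]; apply: out. Qed.

Section Closure.

Context {E : Type} {eE : Enc E}.

Lemma computable_id : computable (fun e : E => e).
Proof. by apply: (computes_expr (e := EVar 0)). Qed.

Fixpoint const_expr (t : tree) : texpr :=
  if t is Pair l r then EPair (const_expr l) (const_expr r) else ELeaf.

Lemma eval_const s t : eval s (const_expr t) = t.
Proof. by elim: t => //= l -> r ->. Qed.

Lemma computable_const B {eB : Enc B} (b : B) : computable (fun e : E => b).
Proof.
by apply: (computes_expr (e := const_expr (enc b))) => d _; apply: eval_const.
Qed.

Lemma computable_app A B {eA : Enc A} {eB : Enc B} (f : A -> B) (g : E -> A) :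
  computable f -> computable g -> computable (fun e => f (g e)).
Proof.
move=> cf cg; apply: computes_comp cg _.
by apply: computes_reindex cf _ => d _; exists (g d).
Qed.

Lemma computable_expr A B {eA : Enc A} {eB : Enc B} (f : A -> B) (g : E -> A) x :
  (forall a, eval (upd (fun=> Leaf) 0 (enc a)) x = enc (f a)) ->
  computable g -> computable (fun e => f (g e)).
Proof. by move=> fE; apply: computable_app; apply: (computes_expr (e := x)). Qed.

Lemma computable_pair A B {eA : Enc A} {eB : Enc B} (f : E -> A) (g : E -> B) :
  computable f -> computable g -> computable (fun e => (f e, g e)).
Proof. exact: computes_pair. Qed.

Lemma computable_app2 A B C {eA : Enc A} {eB : Enc B} {eC : Enc C} (F : A -> B -> C)
    (f : E -> A) (g : E -> B) :
  computable (fun p : A * B => F p.1 p.2) -> computable f -> computable g ->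
  computable (fun e => F (f e) (g e)).
Proof. by move=> cF cf cg; apply: (computable_app cF (computable_pair cf cg)). Qed.

Lemma computable_app3 A B C D {eA : Enc A} {eB : Enc B} {eC : Enc C} {eD : Enc D}
    (F : A -> B -> C -> D) (f : E -> A) (g : E -> B) (h : E -> C) :
  computable (fun p : A * (B * C) => F p.1 p.2.1 p.2.2) ->
  computable f -> computable g -> computable h ->
  computable (fun e => F (f e) (g e) (h e)).
Proof.
by move=> cF cf cg ch;
  apply: (computable_app cF (computable_pair cf (computable_pair cg ch))).
Qed.

Lemma computable_fst A B {eA : Enc A} {eB : Enc B} (f : E -> A * B) :
  computable f -> computable (fun e => (f e).1).
Proof. by apply: (computable_expr (x := EHd (EVar 0))). Qed.

Lemma computable_snd A B {eA : Enc A} {eB : Enc B} (f : E -> A * B) :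
  computable f -> computable (fun e => (f e).2).
Proof. by apply: (computable_expr (x := ETl (EVar 0))). Qed.

Lemma computable_thd (f : E -> tree) : computable f -> computable (fun e => thd (f e)).
Proof. by apply: (computable_expr (x := EHd (EVar 0))). Qed.

Lemma computable_ttl (f : E -> tree) : computable f -> computable (fun e => ttl (f e)).
Proof. by apply: (computable_expr (x := ETl (EVar 0))). Qed.

(** A tree is its own encoding, so passing from a value to its encoding leaves the tree unchanged.
    Values of any encoded type can thus be treated as trees. *)
Lemma computable_enc A {eA : Enc A} (f : E -> A) :
  computable f -> computable (fun e => enc (f e)).
Proof. by []. Qed.

Lemma computable_cons A {eA : Enc A} (f : E -> A) (g : E -> seq A) :
  computable f -> computable g -> computable (fun e => f e :: g e).
Proof. exact: computes_pair. Qed.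

Lemma computable_behead A {eA : Enc A} (f : E -> seq A) :
  computable f -> computable (fun e => behead (f e)).
Proof. by apply: (computable_expr (x := ETl (EVar 0))) => -[]. Qed.

Lemma computable_inl A B {eA : Enc A} {eB : Enc B} (f : E -> A) :
  computable f -> computable (fun e => inl (f e) : A + B).
Proof. by apply: (computable_expr (x := EPair ELeaf (EVar 0))). Qed.

Lemma computable_inr A B {eA : Enc A} {eB : Enc B} (f : E -> B) :
  computable f -> computable (fun e => inr (f e) : A + B).
Proof. by apply: (computable_expr (x := EPair (EPair ELeaf ELeaf) (EVar 0))). Qed.

Lemma computable_succ (f : E -> nat) : computable f -> computable (fun e => (f e).+1).
Proof. by apply: (computable_expr (x := EPair ELeaf (EVar 0))). Qed.

Lemma computable_pred (f : E -> nat) : computable f -> computable (fun e => (f e).-1).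
Proof. by apply: (computable_expr (x := ETl (EVar 0))) => -[]. Qed.

(** Only whether the guard is a leaf counts. The emptiness of a list, a unary number or a tree is
    therefore tested on the object itself. *)
Lemma computable_ifg A B {eA : Enc A} {eB : Enc B} (h : E -> A) (b : E -> bool)
    (f g : E -> B) :
  computable h -> (forall e, b e = false <-> enc (h e) = Leaf) ->
  computable f -> computable g ->
  computable (fun e => if b e then f e else g e).
Proof.
move=> ch bh [cf outf] [cg outg]; apply: computes_if ch _ _.
  exists cf => e [_ /bh]; case: (b e) => // _; exact: outf.
by exists cg => e [_ /bh ->]; apply: outg.
Qed.

Lemma computable_if B {eB : Enc B} (b : E -> bool) (f g : E -> B) :
  computable b -> computable f -> computable g ->
  computable (fun e => if b e then f e else g e).
Proof. by move=> cb; apply: (computable_ifg cb) => e; case: (b e). Qed.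

Lemma computable_and (b1 b2 : E -> bool) : computable b1 -> computable b2 ->
  computable (fun e => b1 e && b2 e).
Proof.
by move=> ? ?; apply: (computable_if (g := fun=> false)) => //; apply: computable_const.
Qed.

Lemma computable_or (b1 b2 : E -> bool) : computable b1 -> computable b2 ->
  computable (fun e => b1 e || b2 e).
Proof.
by move=> ? ?; apply: (computable_if (f := fun=> true)) => //; apply: computable_const.
Qed.

Lemma computable_neg (b : E -> bool) : computable b -> computable (fun e => ~~ b e).
Proof.
by move=> ?; apply: (computable_if (f := fun=> false) (g := fun=> true)) => //;
  apply: computable_const.
Qed.

Lemma computable_imply (b1 b2 : E -> bool) : computable b1 -> computable b2 ->
  computable (fun e => b1 e ==> b2 e).
Proof.
by move=> ? ?; apply: (computable_if (g := fun=> true)) => //; apply: computable_const.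
Qed.

Definition is_leaf (t : tree) : bool := if t is Leaf then true else false.

Lemma computable_eq0 (f : E -> nat) : computable f -> computable (fun e => f e == 0).
Proof.
move=> cf; have [c out] : computable (fun e => if 0 < f e then false else true).
  by eapply (computable_ifg cf);
    [move=> e; case: (f e) | exact: computable_const | exact: computable_const].
by exists c => e _; move: (out e I); case: (f e).
Qed.

Lemma computable_nilp A {eA : Enc A} (f : E -> seq A) :
  computable f -> computable (fun e => nilp (f e)).
Proof.
move=> cf; have [c out] : computable (fun e => if ~~ nilp (f e) then false else true).
  by eapply (computable_ifg cf);
    [move=> e; case: (f e) | exact: computable_const | exact: computable_const].
by exists c => e _; move: (out e I); case: (f e).
Qed.

Lemma computable_is_leaf (f : E -> tree) : computable f ->
  computable (fun e => is_leaf (f e)).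
Proof.
move=> cf; have [c out] :
    computable (fun e => if ~~ is_leaf (f e) then false else true).
  by eapply (computable_ifg cf);
    [ move=> e; rewrite /enc/=; case: (f e)
    | exact: computable_const | exact: computable_const ].
by exists c => e _; move: (out e I); case: (f e).
Qed.

Lemma computable_ext B {eB : Enc B} (f g : E -> B) : f =1 g -> computable f ->
  computable g.
Proof. by move=> fg [c out]; exists c => e; rewrite -fg; apply: out. Qed.

(** The encodings of [x :: r] and of [(x, r)] are the same tree, so in the non-empty branch the pair
    of [e] and [s e] is already an encoded argument of [g]. *)
Lemma computable_seqcase A B {eA : Enc A} {eB : Enc B} (s : E -> seq A) (f : E -> B)
    (g : E -> A -> seq A -> B) :
  computable s -> computable f ->
  computable (fun p : E * (A * seq A) => g p.1 p.2.1 p.2.2) ->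
  computable (fun e => match s e with [::] => f e | x :: r => g e x r end).
Proof.
move=> cs [cf outf] cg; apply: (computes_if cs).
  apply: (@computes_comp _ _ _ (fun e => Pair (enc e) (enc (s e)))).
    apply: computes_pair; first by apply: computes_dom computable_id.
    exact: computes_dom cs.
  apply: computes_reindex cg _ => e [_]; case: (s e) => // x r _.
  by exists (e, (x, r)).
by exists cf => e []; case: (s e) => // _ _; apply: outf.
Qed.

End Closure.

Lemma computable_while A {eA : Enc A} (b : A -> bool) (f : A -> A) (m : A -> nat) :
  (forall a, ~~ b a -> m (f a) < m a) -> computable (fun a => ~~ b a) ->
  computes (fun a => ~~ b a) enc (fun a => enc (f a)) ->
  computable (fun a => iter (m a) (fun a => if b a then a else f a) a).
Proof.
move=> decr cb cf.
by apply: computes_while decr _ cb cf => a; case: (b a).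
Qed.

Opaque computable.

Section Folds.

Context {E X B : Type} {eE : Enc E} {eX : Enc X} {eB : Enc B}.

Lemma computable_foldl (F : E -> B -> X -> B) (z : E -> B) (l : E -> seq X) :
  computable (fun p : E * (B * X) => F p.1 p.2.1 p.2.2) ->
  computable z -> computable l -> computable (fun e => foldl (F e) (z e) (l e)).
Proof.
move=> cF cz cl.
(* Folding over [take 1] makes one step of the fold without asking for a default element of [X]. The
   program takes the head of the encoded list instead, which is meaningful since the body runs on
   non-empty lists only. *)
pose f (d : E * (seq X * B)) :=
  (d.1, (behead d.2.1, foldl (F d.1) d.2.2 (take 1 d.2.1))).
pose m (d : E * (seq X * B)) := size d.2.1.
have cw := @computable_while _ _ (fun d => nilp d.2.1) f m.
have {}cw : computable
    (fun d => iter (m d) (fun d => if nilp d.2.1 then d else f d) d).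
  apply: cw.
  - by move=> [e [[|x s] b]].
  - by apply: computable_neg; apply: computable_nilp; apply: computable_fst;
    apply: computable_snd; apply: computable_id.
  apply: computes_pair; first by apply: (computes_expr (e := EHd (EVar 0))).
  apply: computes_pair.
    by apply: (computes_expr (e := ETl (EHd (ETl (EVar 0))))) => -[e [[|x s] b]].
  apply: computes_comp (_ : computes _ _ (fun d => Pair (enc d.1)
    (Pair (enc d.2.2) (thd (enc d.2.1))))) _.
    by apply: (computes_expr (e := EPair (EHd (EVar 0)) (EPair (ETl (ETl (EVar 0)))
                 (EHd (EHd (ETl (EVar 0))))))).
  apply: computes_reindex cF _ => -[e [[|x s] b]] //= _.
  by exists (e, (b, x)) => //=; rewrite take0.
apply: (computable_ext (f := fun e =>
  (iter (m (e, (l e, z e))) (fun d => if nilp d.2.1 then d else f d)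
     (e, (l e, z e))).2.2)).
  move=> e; rewrite /m [size _]/=; elim: (l e) (z e) => // x s IH b.
  by rewrite [size _]/= iterSr /= /f /= take0; apply: IH.
apply: computable_snd; apply: computable_snd; apply: computable_app cw _;
  apply: computable_pair; first exact: computable_id.
exact: computable_pair.
Qed.

End Folds.

(** * Computable functions on lists and unary numbers *)

Section Lists.

Context {E : Type} {eE : Enc E}.

Lemma computable_rev X {eX : Enc X} (s : E -> seq X) :
  computable s -> computable (fun e => rev (s e)).
Proof.
move=> cs; apply: (computable_ext (f := fun e => foldl (fun r x => x :: r) [::] (s e))).
  by move=> e; rewrite -(revK (s e)) foldl_rev revK; elim: (rev _) => //= x r ->.
apply: computable_foldl (computable_const _) cs.
by apply: computable_cons; do ?[apply: computable_fst|apply: computable_snd];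
  apply: computable_id.
Qed.

Lemma computable_foldr X B {eX : Enc X} {eB : Enc B} (F : E -> X -> B -> B) (z : E -> B)
    (l : E -> seq X) :
  computable (fun p : E * (X * B) => F p.1 p.2.1 p.2.2) ->
  computable z -> computable l -> computable (fun e => foldr (F e) (z e) (l e)).
Proof.
move=> cF cz cl; apply: (computable_ext (f := fun e =>
  foldl (fun b x => F e x b) (z e) (rev (l e)))).
  by move=> e; rewrite foldl_rev.
apply: computable_foldl cz (computable_rev cl).
by apply: (computable_app3 cF); do ?[apply: computable_fst|apply: computable_snd];
  apply: computable_id.
Qed.

End Lists.

(** Syntax-directed search: the shape of the body selects the closure lemma. [ctac_base] is a hook,
    redefined each time further functions have been shown computable. *)
Ltac ctac_base := fail.
Ltac ctac_step :=
  cbn beta;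
  first
  [ assumption
  | apply: computable_const
  | apply: computable_id
  | exact: (computable_fst computable_id)
  | exact: (computable_snd computable_id)
  | ctac_base
  | lazymatch goal with
    | |- computable (fun e => if _ then _ else _) => apply: computable_if
    | |- computable (fun e => fst _) => apply: computable_fst
    | |- computable (fun e => snd _) => apply: computable_snd
    | |- computable (fun e => (_, _)) => apply: computable_pair
    | |- computable (fun e => _ :: _) => apply: computable_cons
    | |- computable (fun e => thd _) => apply: computable_thd
    | |- computable (fun e => ttl _) => apply: computable_ttl
    | |- computable (fun e => is_leaf _) => apply: computable_is_leaf
    | |- computable (fun e => enc _) => apply: computable_enc
    | |- computable (fun e => behead _) => apply: computable_behead
    | |- computable (fun e => inl _) => apply: computable_inl
    | |- computable (fun e => inr _) => apply: computable_inr
    | |- computable (fun e => _.+1) => apply: computable_succ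
    | |- computable (fun e => _.-1) => apply: computable_pred
    | |- computable (fun e => _ && _) => apply: computable_and
    | |- computable (fun e => _ || _) => apply: computable_or
    | |- computable (fun e => ~~ _) => apply: computable_neg
    | |- computable (fun e => _ ==> _) => apply: computable_imply
    | |- computable (fun e => nilp _) => apply: computable_nilp
    | |- computable (fun e => match _ with [::] => _ | _ :: _ => _ end) =>
        apply: computable_seqcase
    | |- computable (fun e => foldl _ _ _) => apply: computable_foldl
    | |- computable (fun e => foldr _ _ _) => apply: computable_foldr
    end
  | match goal with H : computable _ |- computable _ =>
      first [ apply: (computable_app3 H) | apply: (computable_app2 H)
            | apply: (computable_app H) ] end ].
Ltac ctac := repeat ctac_step.

Section Lists2.

Context {E X : Type} {eE : Enc E} {eX : Enc X}.

Lemma computable_map B {eB : Enc B} (f : E -> X -> B) (s : E -> seq X) :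
  computable (fun p : E * X => f p.1 p.2) -> computable s ->
  computable (fun e => map (f e) (s e)).
Proof.
move=> cf cs.
apply: (computable_ext (f := fun e => foldr (fun x r => f e x :: r) [::] (s e))).
  by move=> e; elim: (s e) => //= x r ->.
by ctac.
Qed.

Lemma computable_cat (s r : E -> seq X) :
  computable s -> computable r -> computable (fun e => s e ++ r e).
Proof.
move=> cs cr; apply: (computable_ext (f := fun e => foldr cons (r e) (s e))).
  by move=> e; elim: (s e) => //= x t ->.
by ctac.
Qed.

Lemma computable_filter (f : E -> X -> bool) (s : E -> seq X) :
  computable (fun p : E * X => f p.1 p.2) -> computable s ->
  computable (fun e => filter (f e) (s e)).
Proof.
move=> cf cs.
apply: (computable_ext (f := fun e => foldr (fun x r => if f e x then x :: r else r)
  [::] (s e))).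
  by move=> e; elim: (s e) => //= x r ->.
by ctac.
Qed.

Lemma computable_has (f : E -> X -> bool) (s : E -> seq X) :
  computable (fun p : E * X => f p.1 p.2) -> computable s ->
  computable (fun e => has (f e) (s e)).
Proof.
move=> cf cs.
apply: (computable_ext (f := fun e => foldr (fun x r => f e x || r) false (s e))).
  by move=> e; elim: (s e) => //= x r ->.
by ctac.
Qed.

Lemma computable_all (f : E -> X -> bool) (s : E -> seq X) :
  computable (fun p : E * X => f p.1 p.2) -> computable s ->
  computable (fun e => all (f e) (s e)).
Proof.
move=> cf cs.
apply: (computable_ext (f := fun e => foldr (fun x r => f e x && r) true (s e))).
  by move=> e; elim: (s e) => //= x r ->.
by ctac.
Qed.

Lemma computable_head (z : E -> X) (s : E -> seq X) :
  computable z -> computable s -> computable (fun e => head (z e) (s e)).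
Proof. by move=> cz cs; rewrite /head; ctac. Qed.

(* In unary, a number is the list of its units. *)
Lemma computable_iter (f : E -> X -> X) (z : E -> X) (n : E -> nat) :
  computable (fun p : E * X => f p.1 p.2) -> computable z -> computable n ->
  computable (fun e => iter (n e) (f e) (z e)).
Proof.
move=> cf cz cn.
apply: (computable_ext (f := fun e => foldr (fun=> f e) (z e) (nseq (n e) Leaf))).
  by move=> e; elim: (n e) => //= k ->.
apply: computable_foldr cz _; first by ctac.
have enc_nseq k : enc k = enc (nseq k Leaf) by elim: k => // k IH; congr Pair;
  apply: IH.
by apply: computes_comp cn (computes_expr (e := EVar 0) _) => e _; exact: enc_nseq.
Qed.

End Lists2.

Section Lists3.

Context {E X : Type} {eE : Enc E} {eX : Enc X}.

Lemma computable_flatten (s : E -> seq (seq X)) :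
  computable s -> computable (fun e => flatten (s e)).
Proof.
by move=> cs; rewrite /flatten; apply: computable_foldr => //;
  [apply: computable_cat|]; ctac.
Qed.

Lemma computable_size (s : E -> seq X) : computable s ->
  computable (fun e => size (s e)).
Proof.
move=> cs; apply: (computable_ext (f := fun e => foldr (fun=> succn) 0 (s e))).
  by move=> e; elim: (s e) => //= x r ->.
by ctac.
Qed.

Lemma computable_count (f : E -> X -> bool) (s : E -> seq X) :
  computable (fun p : E * X => f p.1 p.2) -> computable s ->
  computable (fun e => count (f e) (s e)).
Proof.
move=> cf cs; apply: (computable_ext (f := fun e => size (filter (f e) (s e)))).
  by move=> e; rewrite size_filter.
by apply: computable_size; apply: computable_filter.
Qed.

Lemma computable_addn (m n : E -> nat) :
  computable m -> computable n -> computable (fun e => m e + n e).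
Proof.
move=> cm cn; apply: (computable_ext (f := fun e => iter (m e) succn (n e))).
  by move=> e; rewrite iter_succn addnC.
by apply: computable_iter; ctac.
Qed.

Lemma computable_subn (m n : E -> nat) :
  computable m -> computable n -> computable (fun e => m e - n e).
Proof.
move=> cm cn; apply: (computable_ext (f := fun e => iter (n e) predn (m e))).
  by move=> e; rewrite iter_predn.
by apply: computable_iter; ctac.
Qed.

Lemma computable_leq (m n : E -> nat) :
  computable m -> computable n -> computable (fun e => m e <= n e).
Proof.
by move=> cm cn; rewrite /leq; apply: computable_eq0; apply: computable_subn.
Qed.

End Lists3.

Ltac ctac_list :=
  lazymatch goal with
  | |- computable (fun e => map _ _) => apply: computable_map
  | |- computable (fun e => _ ++ _) => apply: computable_cat
  | |- computable (fun e => filter _ _) => apply: computable_filter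
  | |- computable (fun e => has _ _) => apply: computable_has
  | |- computable (fun e => all _ _) => apply: computable_all
  | |- computable (fun e => head _ _) => apply: computable_head
  | |- computable (fun e => iter _ _ _) => apply: computable_iter
  | |- computable (fun e => flatten _) => apply: computable_flatten
  | |- computable (fun e => size _) => apply: computable_size
  | |- computable (fun e => count _ _) => apply: computable_count
  | |- computable (fun e => _ + _) => apply: computable_addn
  | |- computable (fun e => _ - _) => apply: computable_subn
  | |- computable (fun e => _ <= _) => apply: computable_leq
  end.

Ltac ctac_base ::= ctac_list.

(** * Equality of trees and of encoded values *)

(* Stack machine: the list of pairs of subtrees still to be compared. *)
Definition teq_step (d : seq (tree * tree) * bool) : seq (tree * tree) * bool :=
  match d.1 with
  | [::] => d
  | p :: s =>
    if is_leaf p.1 then (if is_leaf p.2 then (s, d.2) else ([::], false))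
    else if is_leaf p.2 then ([::], false)
    else ((thd p.1, thd p.2) :: (ttl p.1, ttl p.2) :: s, d.2)
  end.

(** Measuring the left components is enough: every step removes at least one node from them, whether
    it splits a pair, drops two leaves or gives up on a mismatch. *)
Definition teq_size (d : seq (tree * tree) * bool) : nat :=
  sumn [seq Defs.tsize p.1 | p <- d.1].

Definition teq (t1 t2 : tree) : bool :=
  let d := ([:: (t1, t2)], true) in
  (iter (teq_size d) (fun d => if nilp d.1 then d else teq_step d) d).2.

Lemma tree_size_gt0 t : 0 < Defs.tsize t. Proof. by case: t. Qed.

Lemma teq_step_decr d : ~~ nilp d.1 -> teq_size (teq_step d) < teq_size d.
Proof.
case: d => [[//|[[|l1 r1] [|l2 r2]] s] b] _; rewrite /teq_size /teq_step /=; try lia.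
Qed.

Lemma teqP : Equality.axiom teq.
Proof.
move=> t1 t2; set d := ([:: (t1, t2)], true).
pose alleq := foldr (fun (p : tree * tree) P => p.1 = p.2 /\ P) True.
(* Loop invariant: the final answer is the current flag together with the equality of all pending
   pairs. *)
suff loopP n s b : teq_size (s, b) <= n -> reflect (b /\ alleq s)
    (iter n (fun d => if nilp d.1 then d else teq_step d) (s, b)).2.
  apply: (iffP (loopP _ [:: (t1, t2)] true (leqnn _))); last by move->.
  by case=> _ [].
elim: n s b => [|n IH] s b le_n.
  case: s le_n => [|p s]; first by move=> _; apply: (iffP idP) => // -[].
  by rewrite /teq_size /=; have := tree_size_gt0 p.1; lia.
have [s0|s0] := boolP (nilp s).
  have -> : iter n.+1 (fun d => if nilp d.1 then d else teq_step d) (s, b) = (s, b).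
    by elim: n.+1 => //= m ->; rewrite s0.
  by move: s0 => /nilP->; apply: (iffP idP) => // -[].
have ltn : teq_size (teq_step (s, b)) <= n.
  by rewrite -ltnS; apply: leq_trans le_n; apply: teq_step_decr.
rewrite iterSr /= (negPf s0); case: s s0 ltn {le_n} => //= -[u1 u2] s _.
rewrite /teq_step /=; case: u1 u2 => [|l1 r1] [|l2 r2] /= /IH loopP.
- by apply: (iffP loopP) => [] [? ?]; split=> //; tauto.
- by apply: (iffP loopP) => [] [? []].
- by apply: (iffP loopP) => [] [? []].
apply: (iffP loopP) => /= -[? H]; split=> //; first by case: H => -> [-> ?].
by case: H => -[-> ->] ?.
Qed.

HB.instance Definition _ := hasDecEq.Build tree teqP.

Lemma computable_teq : computable (fun p : tree * tree => teq p.1 p.2).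
Proof.
have cw := @computable_while _ _ (fun d => nilp (T := tree * tree) d.1) _ _
  teq_step_decr.
have {}cw : computable (fun d => iter (teq_size d)
    (fun d => if nilp d.1 then d else teq_step d) d).
  apply: cw; first by ctac.
  by apply: computes_dom (_ : computable teq_step) => //; rewrite /teq_step; ctac.
have cg : computable (fun p : tree * tree => ([:: (p.1, p.2)], true)) by ctac.
exact: (computable_snd (computable_app cw cg)).
Qed.

Class EncInj (A : Type) {eA : Enc A} : Prop := enc_inj : injective (enc (A := A)).

#[local] Instance EncInj_tree : EncInj (A := tree).
Proof. by []. Qed.

#[local] Instance EncInj_unary : EncInj (A := nat).
Proof. by elim=> [|m IH] [|n] // -[/IH->]. Qed.

#[local] Instance EncInj_prod A B (eA : Enc A) (eB : Enc B)
    (iA : EncInj (A := A)) (iB : EncInj (A := B)) : EncInj (A := A * B).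
Proof. by case=> a b [a' b'] [/iA-> /iB->]. Qed.

#[local] Instance EncInj_sum A B (eA : Enc A) (eB : Enc B)
    (iA : EncInj (A := A)) (iB : EncInj (A := B)) : EncInj (A := A + B).
Proof. by case=> a [] b // [] => [/iA|/iB]->. Qed.

Section Equality.

Context {E : Type} {eE : Enc E} {X : eqType} {eX : Enc X} {iX : EncInj (A := X)}.

Lemma computable_eq (f g : E -> X) :
  computable f -> computable g -> computable (fun e => f e == g e).
Proof.
move=> cf cg; apply: (computable_ext (f := fun e => teq (enc (f e)) (enc (g e)))).
  by move=> e; apply/teqP/eqP => [/iX|->].
exact: (computable_app2 computable_teq (computable_enc cf) (computable_enc cg)).
Qed.

End Equality.

Section Membership.

Context {E : Type} {eE : Enc E} {X : eqType} {eX : Enc X} {iX : EncInj (A := X)}.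

Lemma computable_mem (f : E -> X) (s : E -> seq X) :
  computable f -> computable s -> computable (fun e => f e \in s e).
Proof.
move=> cf cs; apply: (computable_ext (f := fun e => has (fun x => x == f e) (s e))).
  by move=> e; rewrite -has_pred1; apply: eq_has.
by apply: computable_has => //; apply: computable_eq; ctac.
Qed.

End Membership.

(** Any tree is the encoding of a list of trees, namely of the left subtrees along its right spine;
    reading it as such a list is the identity program. *)
Fixpoint spine (t : tree) : seq tree := if t is Pair l r then l :: spine r else [::].

Lemma enc_spine t : enc (spine t) = t.
Proof. by elim: t => // l _ r IH; congr Pair; apply: IH. Qed.

Lemma computable_spine E (eE : Enc E) (f : E -> tree) :
  computable f -> computable (fun e => spine (f e)).
Proof. by apply: (computable_expr (x := EVar 0)) => t; rewrite /= enc_spine. Qed.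

(** Horner's rule: the least significant digit comes first, hence the right fold, and the digit
    [false] is a leaf. *)
Definition dec_nat (t : tree) : nat :=
  foldr (fun b n => if is_leaf b then n + n else (n + n).+1) 0 (spine t).

Lemma enc_natK : cancel enc_nat dec_nat.
Proof.
move=> n; rewrite -{2}(bin_of_natK n) /enc_nat /bits.
case: (bin_of_nat n) => //= p; elim: p => //= p IH.
  by rewrite {1}/dec_nat /= -/(dec_nat _) IH NatTrec.doubleE addnn.
by rewrite {1}/dec_nat /= -/(dec_nat _) IH NatTrec.doubleE addnn.
Qed.

Lemma computable_dec_nat E (eE : Enc E) (f : E -> tree) :
  computable f -> computable (fun e => dec_nat (f e)).
Proof.
by move=> cf; rewrite /dec_nat; apply: computable_foldr;
  [| |apply: computable_spine]; ctac.
Qed.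

(** The low priority keeps [nat] and [bool], which are countable types as well, on their own
    encodings. *)
#[local] Instance Enc_countType (T : countType) : Enc T | 100 := @enc_count T.

#[local] Instance EncInj_countType (T : countType) : EncInj (A := T).
Proof. by move=> x y /(can_inj enc_natK)/(pcan_inj choice.pickleK). Qed.

Ltac ctac_data :=
  lazymatch goal with
  | |- computable (fun e => _ == _) => apply: computable_eq
  | |- computable (fun e => _ \in _) => apply: computable_mem
  | |- computable (fun e => dec_nat _) => apply: computable_dec_nat
  end.
Ltac ctac_base ::= first [ctac_data | ctac_list].

(** * The search, as a function on lists *)

Section Algorithm.

Variables (Se : finType) (Sn N : countType).

Definition lgraph : Type := (seq (N * Sn) * seq (N * Se * N))%type.
Definition lrel : Type := seq (N * N).

(* An encoded expression with its kind: [true] for paths. *)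
Definition code : Type := (bool * tree)%type.

Definition code_of (e : gx_expr Se Sn) : code :=
  match e with
  | inl phi => (false, enc_node_expr phi)
  | inr alpha => (true, enc_path_expr alpha)
  end.

Definition has_tag (k : nat) (x : code) : bool := thd x.2 == enc_nat k.
Definition payload (x : code) : tree := ttl x.2.

Lemma computable_has_tag E (eE : Enc E) k (f : E -> code) :
  computable f -> computable (fun e => has_tag k (f e)).
Proof. by move=> cf; rewrite /has_tag; ctac. Qed.

Lemma computable_payload E (eE : Enc E) (f : E -> code) :
  computable f -> computable (fun e => payload (f e)).
Proof. by move=> cf; rewrite /payload; ctac. Qed.

(** The numbers are the tags of [enc_node_expr] and [enc_path_expr]. Both kinds of expression use
    the same tags, so each child must be given its kind. *)
Definition kids (x : code) : seq code :=
  if x.1 then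
    if [|| has_tag 4 x, has_tag 5 x | has_tag 6 x] then
      [:: (true, thd (payload x)); (true, ttl (payload x))]
    else if has_tag 7 x then [:: (true, payload x)]
    else if has_tag 8 x then [:: (false, payload x)]
    else if has_tag 9 x then [:: (true, thd (payload x))]
    else [::]
  else
    if has_tag 2 x || has_tag 3 x then
      [:: (false, thd (payload x)); (false, ttl (payload x))]
    else if has_tag 4 x then [:: (true, payload x)]
    else if has_tag 5 x || has_tag 6 x then
      [:: (true, thd (payload x)); (true, ttl (payload x))]
    else [::].

Ltac ctac_code := lazymatch goal with
  | |- computable (fun e => has_tag _ _) => apply: computable_has_tag
  | |- computable (fun e => payload _) => apply: computable_payload
  end.
Ltac ctac_base ::= first [ctac_code | ctac_data | ctac_list].

Lemma computable_kids E (eE : Enc E) (f : E -> code) :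
  computable f -> computable (fun e => kids (f e)).
Proof. by move=> cf; rewrite /kids; ctac. Qed.

(* The subexpressions of the pending codes [d.1] are pushed on [d.2], so that they
   end up in postorder. *)
Definition post_step (d : seq code * seq code) : seq code * seq code :=
  match d.1 with
  | [::] => d
  | x :: s => (kids x ++ s, x :: d.2)
  end.

Definition post_size (d : seq code * seq code) : nat :=
  sumn [seq Defs.tsize x.2 | x <- d.1].

(** The measure drops on every tree, also on one that encodes no expression. The children are read
    off the payload, and if the payload is a leaf, the two leaves that then stand for children are
    still smaller than the removed node with its tag. *)
Lemma post_step_decr d : ~~ nilp d.1 -> post_size (post_step d) < post_size d.
Proof.
case: d => [[//|x s] out] _; rewrite /post_size /post_step /= map_cat sumn_cat.
suff : sumn [seq Defs.tsize y.2 | y <- kids x] < Defs.tsize x.2 by lia.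
rewrite /kids /has_tag /payload; case: x => k [|l r] /=.
  by do ![case: ifP => //=].
have := tree_size_gt0 l; have := tree_size_gt0 r.
by case: r => [|r1 r2] /=; do ![case: ifP => _ /=]; lia.
Qed.

Definition postorder (x : code) : seq code :=
  let d := ([:: x], [::]) in
  (iter (post_size d) (fun d => if nilp d.1 then d else post_step d) d).2.

Lemma computable_postorder E (eE : Enc E) (f : E -> code) :
  computable f -> computable (fun e => postorder (f e)).
Proof.
have cw := @computable_while _ _ (fun d => nilp (T := code) d.1) _ _ post_step_decr.
have {}cw : computable (fun d => iter (post_size d)
    (fun d => if nilp d.1 then d else post_step d) d).
  apply: cw; first by ctac.
  apply: computes_dom (_ : computable post_step) => //; rewrite /post_step.
  by ctac; apply: computable_kids; ctac.
move=> cf; have cg : computable (fun e => ([:: f e], @nil code)) by ctac.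
exact: (computable_snd (computable_app cw cg)).
Qed.

Definition lid (g : lgraph) : lrel := [seq (x.1, x.1) | x <- g.1].

Definition ldom (a : lrel) : lrel := [seq (p.1, p.1) | p <- a].

Definition lcomp (a b : lrel) : lrel :=
  flatten [seq [seq (p.1, q.2) | q <- [seq q <- b | q.1 == p.2]] | p <- a].

Definition linter (a b : lrel) : lrel := [seq p <- a | p \in b].

Definition lpow (g : lgraph) (a : lrel) (k : nat) : lrel := iter k (lcomp a) (lid g).

(* The union of the [a^i b] for [i < k]. *)
Definition lsum (a b : lrel) (k : nat) : lrel :=
  iter k (fun r => b ++ lcomp a r) [::].

Definition same_data (g : lgraph) (u w : N) : bool :=
  has (fun x => (x.1 == u) && ((w, x.2) \in g.1)) g.1.

(* [a] and [b] are the values of the subexpressions; a set of nodes is represented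
   as a set of loops. *)
Definition lnode_op (g : lgraph) (x : code) (a b : lrel) : lrel :=
  if has_tag 0 x then [seq (y.1, y.1) | y <- [seq y <- g.1 | enc y.2 == payload x]]
  else if has_tag 1 x then [seq (y.1, y.1) | y <- [seq y <- g.1 | enc y.2 != payload x]]
  else if has_tag 2 x then a ++ b
  else if has_tag 3 x then linter a b
  else if has_tag 4 x then ldom a
  else if has_tag 5 x then
    ldom [seq p <- a | has (fun q => (q.1 == p.1) && same_data g p.2 q.2) b]
  else
    ldom [seq p <- a | has (fun q => (q.1 == p.1) && ~~ same_data g p.2 q.2) b].

Definition lpath_op (g : lgraph) (x : code) (a b : lrel) : lrel :=
  if has_tag 0 x then lid g
  else if has_tag 1 x then [seq (e.1.1, e.2) | e <- g.2]
  else if has_tag 2 x then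
    [seq (e.1.1, e.2) | e <- [seq e <- g.2 | enc e.1.2 == payload x]]
  else if has_tag 3 x then
    [seq (e.2, e.1.1) | e <- [seq e <- g.2 | enc e.1.2 == payload x]]
  else if has_tag 4 x then lcomp a b
  else if has_tag 5 x then a ++ b
  else if has_tag 6 x then linter a b
  else if has_tag 7 x then lsum a (lid g) (size g.1)
  else if has_tag 8 x then a
  (* There are [m.+1 - n] exponents from [n] to [m]; truncated subtraction gives the empty union
     when [m < n]. *)
  else lsum a (lpow g a (dec_nat (thd (ttl (payload x)))))
         ((dec_nat (ttl (ttl (payload x)))).+1 - dec_nat (thd (ttl (payload x)))).

Definition lop (g : lgraph) (x : code) (a b : lrel) : lrel :=
  if x.1 then lpath_op g x a b else lnode_op g x a b.

(** The list from [postorder] has the last child first, so the value of the first child is on top of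
    the stack. [lop] is always handed two values, but only as many as there are children are
    popped. *)
Definition eval_step (g : lgraph) (st : seq lrel) (x : code) : seq lrel :=
  lop g x (head [::] st) (head [::] (behead st)) :: iter (size (kids x)) behead st.

Definition leval (g : lgraph) (x : code) : lrel :=
  head [::] (foldl (eval_step g) [::] (postorder x)).

Definition lholds (g : lgraph) (x : code) : bool :=
  all (fun y => if x.1 then all (fun z => (y.1, z.1) \in leval g x) g.1
                else (y.1, y.1) \in leval g x) g.1.

Definition lmodels (R : seq code) (g : lgraph) : bool := all (lholds g) R.

Section Computability.

Context {E : Type} {eE : Enc E}.

Lemma computable_lid (g : E -> lgraph) : computable g ->
  computable (fun e => lid (g e)).
Proof. by move=> cg; rewrite /lid; ctac. Qed.

Lemma computable_ldom (a : E -> lrel) : computable a ->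
  computable (fun e => ldom (a e)).
Proof. by move=> ca; rewrite /ldom; ctac. Qed.

Lemma computable_lcomp (a b : E -> lrel) :
  computable a -> computable b -> computable (fun e => lcomp (a e) (b e)).
Proof. by move=> ca cb; rewrite /lcomp; ctac. Qed.

Lemma computable_linter (a b : E -> lrel) :
  computable a -> computable b -> computable (fun e => linter (a e) (b e)).
Proof. by move=> ca cb; rewrite /linter; ctac. Qed.

Lemma computable_same_data (g : E -> lgraph) (u w : E -> N) :
  computable g -> computable u -> computable w ->
  computable (fun e => same_data (g e) (u e) (w e)).
Proof. by move=> cg cu cw; rewrite /same_data; ctac. Qed.

End Computability.

Ltac ctac_lrel := lazymatch goal with
  | |- computable (fun e => lid _) => apply: computable_lid
  | |- computable (fun e => ldom _) => apply: computable_ldom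
  | |- computable (fun e => lcomp _ _) => apply: computable_lcomp
  | |- computable (fun e => linter _ _) => apply: computable_linter
  | |- computable (fun e => same_data _ _ _) => apply: computable_same_data
  | |- computable (fun e => kids _) => apply: computable_kids
  | |- computable (fun e => postorder _) => apply: computable_postorder
  end.
Ltac ctac_base ::= first [ctac_lrel | ctac_code | ctac_data | ctac_list].

Section Computability2.

Context {E : Type} {eE : Enc E}.

Lemma computable_lsum (a b : E -> lrel) (k : E -> nat) :
  computable a -> computable b -> computable k ->
  computable (fun e => lsum (a e) (b e) (k e)).
Proof. by move=> ca cb ck; rewrite /lsum; ctac. Qed.

Lemma computable_lpow (g : E -> lgraph) (a : E -> lrel) (k : E -> nat) :
  computable g -> computable a -> computable k ->
  computable (fun e => lpow (g e) (a e) (k e)).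
Proof. by move=> cg ca ck; rewrite /lpow; ctac. Qed.

End Computability2.

Lemma computable_lop E (eE : Enc E) (g : E -> lgraph) (x : E -> code) (a b : E ->
  lrel) :
  computable g -> computable x -> computable a -> computable b ->
  computable (fun e => lop (g e) (x e) (a e) (b e)).
Proof.
move=> cg cx ca cb; rewrite /lop /lpath_op /lnode_op.
apply: computable_if; ctac; try (apply: computable_lsum; ctac);
  try (apply: computable_lpow; ctac).
Qed.

Lemma computable_leval E (eE : Enc E) (g : E -> lgraph) (x : E -> code) :
  computable g -> computable x -> computable (fun e => leval (g e) (x e)).
Proof.
move=> cg cx; rewrite /leval; ctac.
by rewrite /eval_step; ctac; apply: computable_lop; ctac.
Qed.

Lemma computable_lmodels E (eE : Enc E) (R : E -> seq code) (g : E -> lgraph) :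
  computable R -> computable g -> computable (fun e => lmodels (R e) (g e)).
Proof.
move=> cR cg; rewrite /lmodels /lholds; ctac; by apply: computable_leval; ctac.
Qed.

Fixpoint sublists X (s : seq X) : seq (seq X) :=
  if s is x :: r then sublists r ++ map (cons x) (sublists r) else [:: [::]].

Lemma computable_sublists E X (eE : Enc E) (eX : Enc X) (s : E -> seq X) :
  computable s -> computable (fun e => sublists (s e)).
Proof.
move=> cs; apply: (computable_ext (f := fun e =>
  foldr (fun x acc => acc ++ map (cons x) acc) [:: [::]] (s e))).
  by move=> e; elim: (s e) => //= x r ->.
by ctac.
Qed.

Definition inner_edges (ns : seq (N * Sn)) (g : lgraph) : seq (N * Se * N) :=
  [seq e <- g.2 | (e.1.1 \in [seq x.1 | x <- ns]) && (e.2 \in [seq x.1 | x <- ns])].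

Definition candidates (g : lgraph) : seq lgraph :=
  flatten [seq [seq (ns, es) | es <- sublists (inner_edges ns g)] | ns <- sublists g.1].

Definition lsub (g1 g2 : lgraph) : bool :=
  all (fun x => x \in g2.1) g1.1 && all (fun e => e \in g2.2) g1.2.

Definition lproper (g1 g2 : lgraph) : bool := lsub g1 g2 && ~~ lsub g2 g1.

Definition symbols (g : lgraph) : seq (Se + Sn) :=
  [seq inl e.1.2 | e <- g.2] ++ [seq inr x.2 | x <- g.1].

(** The order on multisets quantifies over all symbols, possibly infinitely many. Every symbol that
    matters has a positive multiplicity on one side, so the symbols listed are enough. *)
Definition mset_ltb (lt : rel (Se + Sn)) (s1 s2 : seq (Se + Sn)) : bool :=
  has (fun x => count (fun y => y == x) s1 != count (fun y => y == x) s2) (s1 ++ s2) &&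
  all (fun x => (count (fun y => y == x) s2 < count (fun y => y == x) s1) ==>
    has (fun z => lt x z && (count (fun y => y == z) s1 < count (fun y => y == z)
      s2)) s2)
  s1.

Definition lpreferred (Pref : preference Se Sn) (g1 g2 : lgraph) : bool :=
  match Pref with
  | WeightPref w => sumn (map w (symbols g1)) < sumn (map w (symbols g2))
  | MsetPref lt => mset_ltb lt (symbols g1) (symbols g2)
  end.

Definition maximals X (r : rel X) (s : seq X) : seq X :=
  [seq x <- s | ~~ has (fun y => r x y) s].

Definition solve (Pref : preference Se Sn) (g : lgraph) (R : seq code) : lgraph :=
  head ([::], [::])
    (maximals (lpreferred Pref) (maximals lproper [seq c <- candidates g | lmodels R
      c])).

Section Computability3.

Context {E : Type} {eE : Enc E}.

Lemma computable_candidates (g : E -> lgraph) :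
  computable g -> computable (fun e => candidates (g e)).
Proof.
by move=> cg; rewrite /candidates /inner_edges; ctac; apply: computable_sublists; ctac.
Qed.

Lemma computable_lproper (g1 g2 : E -> lgraph) :
  computable g1 -> computable g2 -> computable (fun e => lproper (g1 e) (g2 e)).
Proof. by move=> ? ?; rewrite /lproper /lsub; ctac. Qed.

Lemma computable_symbols (g : E -> lgraph) :
  computable g -> computable (fun e => symbols (g e)).
Proof. by move=> cg; rewrite /symbols; ctac. Qed.

End Computability3.

Lemma computable_maximals E X (eE : Enc E) (eX : Enc X) (r : E -> rel X) (s : E ->
  seq X) :
  computable (fun p : E * (X * X) => r p.1 p.2.1 p.2.2) -> computable s ->
  computable (fun e => maximals (r e) (s e)).
Proof. by move=> cr cs; rewrite /maximals; ctac. Qed.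

Lemma polytime_computable A B (eA : Enc A) (eB : Enc B) (f : A -> B) :
  polytime eA eB f -> computable f.
Proof.
by case=> c [a [k run_c]]; exists c => x _; have [n run_n _] := run_c x; exists n.
Qed.

Lemma computable_lpreferred E (eE : Enc E) Pref (g1 g2 : E ->
  lgraph) : admissible Pref ->
  computable g1 -> computable g2 ->
  computable (fun e => lpreferred Pref (g1 e) (g2 e)).
Proof.
case: Pref => [w|lt] /= adm cg1 cg2.
  (* The program for [w] answers in binary. Decoding to unary may be exponential, which is harmless
     without a time bound. *)
  have cw : computable w.
    apply: (computable_ext (f := fun x => dec_nat (enc_nat (w x)))).
      by move=> x; rewrite enc_natK.
    apply: computable_dec_nat; have [c [a [k run_c]]] := adm.
    by exists c => x _; have [n run_n _] := run_c x; exists n.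
  have cs g : computable g -> computable (fun e : E => sumn (map w (symbols (g e)))).
    by move=> cg; rewrite /sumn; ctac; apply: computable_symbols.
  by have cs1 := cs _ cg1; have cs2 := cs _ cg2; ctac.
case: adm => _ _ _ /polytime_computable clt.
have clt2 : computable (fun p => lt p.1 p.2) := clt.
by rewrite /mset_ltb; ctac; apply: computable_symbols; ctac.
Qed.

Lemma computable_solve E (eE : Enc E) Pref (g : E -> lgraph) (R : E -> seq code) :
  admissible Pref -> computable g -> computable R ->
  computable (fun e => solve Pref (g e) (R e)).
Proof.
move=> adm cg cR; rewrite /solve; ctac.
apply: computable_maximals; first by apply: computable_lpreferred => //; ctac.
apply: computable_maximals; first by apply: computable_lproper; ctac.
apply: computable_filter; last exact: computable_candidates.
by apply: computable_lmodels; ctac.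
Qed.

End Algorithm.

(** * Evaluation of expressions *)

(** Halted states are fixed points, so the fuel [m a] and any other number of iterations that
    reaches a halted state give the same result. Traces can thus be counted without computing the
    fuel. *)
Lemma iter_halt A (b : A -> bool) (f : A -> A) (m : A -> nat) n a :
  let h := fun a => if b a then a else f a in
  (forall a, ~~ b a -> m (f a) < m a) ->
  b (iter n h a) -> iter (m a) h a = iter n h a.
Proof.
move=> h decr bn.
have fixh k c : b c -> iter k h c = c.
  by move=> bc; elim: k => //= k ->; rewrite /h bc.
have haltm k c : m c <= k -> b (iter k h c).
  elim: k c => [|k IH] c le_m; have [bc|nbc] := boolP (b c).
  - by [].
  - by have := decr _ nbc; rewrite ltnNge (leq_trans le_m).
  - by have /= -> := fixh k.+1 c bc.
  rewrite -[iter _ _ _]/(iter k.+1 h c) iterSr {2}/h (negPf nbc); apply: IH.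
  by rewrite -ltnS (leq_trans (decr _ nbc)).
have bm := haltm _ _ (leqnn (m a)).
case: (leqP (m a) n) => [le|/ltnW le].
  by rewrite -(subnK le) iterD (fixh _ _ bm).
by rewrite -(subnK le) iterD (fixh _ _ bn).
Qed.

Scheme node_expr_mut := Induction for node_expr Sort Prop
  with path_expr_mut := Induction for path_expr Sort Prop.
Combined Scheme gx_expr_mut from node_expr_mut, path_expr_mut.

(** If the first element [x] is not maximal, pass to the elements above [x]: the list is shorter
    because [x] is not above itself, and what is maximal there is maximal in the whole list by
    transitivity. *)
Lemma maximals_nonempty (X : eqType) (r : rel X) (s : seq X) :
  irreflexive r -> transitive r -> s != [::] -> maximals r s != [::].
Proof.
move=> rI rT; have [n] := ubnP (size s); elim: n s => // n IH s ltsn s0.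
case: s s0 ltsn => // x s _ ltsn; set t := x :: s.
have [hx|nhx] := boolP (has (r x) t); last first.
  suff : x \in maximals r t by case: maximals.
  by rewrite mem_filter nhx mem_head.
have [y] : exists y, y \in maximals r (filter (r x) t).
  have : maximals r (filter (r x) t) != [::].
    apply: IH; last by rewrite -has_filter.
    rewrite size_filter /= rI add0n.
    by have := count_size (r x) s; rewrite /= in ltsn; lia.
  by case: maximals => // y ? _; exists y; rewrite mem_head.
rewrite mem_filter => /andP[nhy]; rewrite mem_filter => /andP[rxy yt].
suff : y \in maximals r t by case: maximals.
rewrite mem_filter yt andbT; apply: contra nhy => /hasP[z zt ryz].
by apply/hasP; exists z => //; rewrite mem_filter (rT _ _ _ rxy ryz).
Qed.

(** * Stack evaluation along the postorder *)

Section Postorder.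

Variables (Se : finType) (Sn N : countType) (g : lgraph Se Sn N).

Definition post_iter n d :=
  iter n (fun d => if nilp (T := code) d.1 then d else post_step d) d.

(* After the postorder traversal of [x], evaluation pushes exactly the value [v]. *)
Definition valued (x : code) (v : lrel N) : Prop := exists n l,
  (forall s out, post_iter n (x :: s, out) = (s, l ++ out)) /\
  (forall st, foldl (eval_step g) st l = v :: st).

Lemma post_iterD m n d : post_iter (m + n) d = post_iter m (post_iter n d).
Proof. exact: iterD. Qed.

Lemma leval_valued x v : valued x v -> leval g x = v.
Proof.
case=> n [l [post_l eval_l]]; rewrite /leval /postorder.
have halts : nilp (T := code) (post_iter n ([:: x], [::])).1 by rewrite post_l.
rewrite (iter_halt post_step_decr halts) -/(post_iter n _) post_l cats0.
by rewrite eval_l.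
Qed.

Lemma valued0 x v : kids x = [::] -> (forall a b, lop g x a b = v) -> valued x v.
Proof.
move=> kx opx; exists 1, [:: x]; split=> [s out|st] /=.
  by rewrite /post_step /= kx.
by rewrite /eval_step kx /= opx.
Qed.

Lemma valued1 x x0 v0 v : kids x = [:: x0] -> valued x0 v0 ->
  (forall b, lop g x v0 b = v) -> valued x v.
Proof.
move=> kx [n0 [l0 [post0 eval0]]] opx; exists (n0 + 1), (l0 ++ [:: x]).
split=> [s out|st].
  by rewrite post_iterD /= /post_step /= kx post0 -catA.
by rewrite foldl_cat eval0 /= /eval_step kx /= opx.
Qed.

Lemma valued2 x x0 x1 v0 v1 v : kids x = [:: x0; x1] -> valued x0 v0 ->
  valued x1 v1 -> lop g x v0 v1 = v -> valued x v.
Proof.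
move=> kx [n0 [l0 [post0 eval0]]] [n1 [l1 [post1 eval1]]] opx.
(* The traversal meets [x], then [x0], then [x1], and prepends each; evaluation therefore runs
   through [x1], [x0], [x] and leaves [v0] above [v1]. *)
exists (n1 + (n0 + 1)), (l1 ++ l0 ++ [:: x]); split=> [s out|st].
  by rewrite !post_iterD /= /post_step /= kx /= post0 post1 -!catA.
by rewrite !foldl_cat eval1 eval0 /= /eval_step kx /= opx.
Qed.

End Postorder.

(** * Lists of pairs against relations on nodes *)

Section ListRelations.

Variables (Se : finType) (Sn N : countType) (g : lgraph Se Sn N).
Implicit Types (a b : lrel N).

Lemma ldomP a x y : reflect (x = y /\ exists z, (x, z) \in a) ((x, y) \in ldom a).
Proof.
apply: (iffP mapP) => [[[u v] uv [-> ->]]|[<- [z xz]]].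
  by split=> //; exists v.
by exists (x, z).
Qed.

Lemma lcompP a b x y :
  reflect (exists z, (x, z) \in a /\ (z, y) \in b) ((x, y) \in lcomp a b).
Proof.
apply: (iffP flatten_mapP) => [[[u z] uz /mapP[[z' v]]]|[z [xz zy]]].
  by rewrite mem_filter => /andP[/= /eqP-> zv] [-> ->]; exists z.
exists (x, z) => //; apply/mapP; exists (z, y) => //.
by rewrite mem_filter /= eqxx.
Qed.

Lemma lsumP a b k p :
  reflect (exists2 i, i < k & p \in iter i (lcomp a) b) (p \in lsum a b k).
Proof.
elim: k p => [|k IH] p; first by apply: (iffP idP) => // -[].
rewrite /lsum /= -/(lsum a b k) mem_cat; case: p => x y.
apply: (iffP orP) => [[xy|/lcompP[z [xz /IH[i lti zy]]]]|[[|i] lti /= xy]].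
- by exists 0.
- by exists i.+1 => //=; apply/lcompP; exists z.
- by left.
- by right; move: xy => /lcompP[z [xz zy]]; apply/lcompP; exists z; split=> //;
    apply/IH; exists i.
Qed.

End ListRelations.

Lemma rcompP (T : finType) (A B : {set T * T}) x y :
  reflect (exists z, (x, z) \in A /\ (z, y) \in B) ((x, y) \in rcomp A B).
Proof.
rewrite inE; apply: (iffP existsP) => -[z].
  by move=> /andP[xz zy]; exists z.
by move=> [xz zy]; exists z; apply/andP.
Qed.

Lemma rpow_path (T : finType) (A : {set T * T}) x p :
  path (fun x y => (x, y) \in A) x p -> (x, last x p) \in rpow A (size p).
Proof.
elim: p x => [|y p IH] x /=; first by rewrite inE /= inE eqxx.
by move=> /andP[xy /IH yp]; apply/rcompP; exists y.
Qed.

Lemma rpow_connect (T : finType) (A : {set T * T}) k x y :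
  (x, y) \in rpow A k -> connect (fun x y => (x, y) \in A) x y.
Proof.
elim: k x => [|k IH] x /=; first by rewrite inE /= => /andP[_ /eqP->].
by move=> /rcompP[z [xz /IH]]; apply: connect_trans; apply: connect1.
Qed.

(** Form of [represents] without permutations, by membership and absence of repetitions;
    [representsP] gives the equivalence. Uniqueness bears on the node names and not just on the
    pairs, so that no node is listed with two data values. *)
Record lrep (Se : finType) (Sn N : countType) (g : lgraph Se Sn N)
    (G : data_graph Se Sn N) : Prop := LRep {
  lrep_uniq_nodes : uniq [seq x.1 | x <- g.1];
  lrep_uniq_edges : uniq g.2;
  lrep_nodes : forall x, (x \in nodes G) = (x \in [seq y.1 | y <- g.1]);
  lrep_data : forall (v : nodes G) c, ((val v, c) \in g.1) = (data G v == c);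
  lrep_labels : forall (u v : nodes G) a,
    ((val u, a, val v) \in g.2) = (a \in labels G (u, v));
  lrep_ends : forall e, e \in g.2 -> (e.1.1 \in nodes G) && (e.2 \in nodes G) }.

Section Semantics.

Variables (Se : finType) (Sn N : countType).
Variables (g : lgraph Se Sn N) (G : data_graph Se Sn N).
Hypothesis gG : lrep g G.
Implicit Types (r : lrel N) (S : {set nodes G * nodes G}).

Lemma lrep_mem_node x : x \in g.1 -> exists2 v : nodes G, x.1 = val v & x.2 = data G v.
Proof.
case: x => y c xg; have yG : y \in nodes G.
  by rewrite (lrep_nodes gG); apply/mapP; exists (y, c).
by exists [` yG]%fset => //=; apply/esym/eqP; rewrite -(lrep_data gG).
Qed.

Lemma lrep_mem_data (v : nodes G) : (val v, data G v) \in g.1.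
Proof. by rewrite (lrep_data gG). Qed.

Lemma lrep_mem_edge e : e \in g.2 -> exists u v : nodes G,
  [/\ e.1.1 = val u, e.2 = val v & e.1.2 \in labels G (u, v)].
Proof.
case: e => [[x a] y] eg; have /andP[/= xG yG] := lrep_ends gG eg.
by exists [` xG]%fset, [` yG]%fset; rewrite -(lrep_labels gG).
Qed.

(** Repetitions in [r] are allowed, as relations are only used through membership. The second clause
    excludes pairs outside the graph, which the first cannot see. *)
Definition prep (r : lrel N) (S : {set nodes G * nodes G}) : Prop :=
  (forall u v, ((val u, val v) \in r) = ((u, v) \in S)) /\
  (forall x y, (x, y) \in r -> exists u v : nodes G, x = val u /\ y = val v).

Lemma prep_ex r S x y : prep r S -> (x, y) \in r ->
  exists u v, [/\ x = val u, y = val v & (u, v) \in S].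
Proof.
case=> rS rG xy; have [u [v [xu yv]]] := rG _ _ xy.
by exists u, v; rewrite -rS -xu -yv.
Qed.

Lemma prepI r S :
  (forall x y, (x, y) \in r -> exists u v, [/\ x = val u, y = val v & (u, v) \in S]) ->
  (forall u v, (u, v) \in S -> (val u, val v) \in r) -> prep r S.
Proof.
move=> rS Sr; split=> [u v|x y /rS[u [v [-> -> _]]]]; last by exists u, v.
apply/idP/idP; last exact: Sr.
by move=> /rS[u' [v' [/val_inj<- /val_inj<-]]].
Qed.

Lemma prep_nodes (r : lrel N) (S : {set nodes G}) :
  (forall x y, (x, y) \in r -> exists u, [/\ x = val u, y = val u & u \in S]) ->
  (forall u, u \in S -> (val u, val u) \in r) -> prep r (rdiag S).
Proof.
move=> rS Sr; apply: prepI => [x y /rS[u [-> -> uS]]|u v].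
  by exists u, u; rewrite inE /= uS eqxx.
by rewrite inE /= => /andP[uS /eqP<-]; apply: Sr.
Qed.

Lemma prep_nodesE r (S : {set nodes G}) u : prep r (rdiag S) ->
  ((val u, val u) \in r) = (u \in S).
Proof. by case=> -> _; rewrite inE /= eqxx andbT. Qed.

Lemma prep_lid : prep (lid g) (rdiag [set: nodes G]).
Proof.
apply: prep_nodes => [x y /mapP[z /lrep_mem_node[v zv _] [-> ->]]|u _].
  by exists v; rewrite inE.
by apply/mapP; exists (val u, data G u) => //; apply: lrep_mem_data.
Qed.

Lemma prep_cat r1 r2 S1 S2 : prep r1 S1 -> prep r2 S2 -> prep (r1 ++ r2) (S1 :|: S2).
Proof.
move=> [e1 d1] [e2 d2]; split=> [u v|x y]; first by rewrite mem_cat inE e1 e2.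
by rewrite mem_cat => /orP[/d1|/d2].
Qed.

Lemma prep_inter r1 r2 S1 S2 : prep r1 S1 -> prep r2 S2 ->
  prep (linter r1 r2) (S1 :&: S2).
Proof.
move=> [e1 d1] [e2 _]; split=> [u v|x y]; first by rewrite mem_filter inE e1 e2 andbC.
by rewrite mem_filter => /andP[_ /d1].
Qed.

Lemma prep_lcomp r1 r2 S1 S2 : prep r1 S1 -> prep r2 S2 ->
  prep (lcomp r1 r2) (rcomp S1 S2).
Proof.
move=> p1 p2; apply: prepI => [x y /lcompP[z [/(prep_ex p1)]]|u v /rcompP[z [uz zv]]].
  move=> [u [z' [-> -> uz]]] /(prep_ex p2)[z2 [v [/val_inj<- -> zv]]].
  by exists u, v; split=> //; apply/rcompP; exists z'.
by apply/lcompP; exists (val z); rewrite p1.1 p2.1.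
Qed.

Lemma prep_iter r1 r2 S1 S2 k : prep r1 S1 -> prep r2 S2 ->
  prep (iter k (lcomp r1) r2) (iter k (rcomp S1) S2).
Proof. by move=> p1 p2; elim: k => //= k; apply: prep_lcomp. Qed.

(** A path can be shortened to one that repeats no node. It then has fewer edges than there are
    nodes, so the powers below [size g.1] suffice. *)
Lemma prep_star r S : prep r S -> prep (lsum r (lid g) (size g.1)) (rstar S).
Proof.
move=> rS; have pr k : prep (iter k (lcomp r) (lid g)) (rpow S k).
  exact: prep_iter rS prep_lid.
apply: prepI => [x y /lsumP[k _ /(prep_ex (pr k))]|u v].
  move=> [u [v [-> -> uv]]]; exists u, v; split=> //.
  by rewrite inE; apply: rpow_connect uv.
rewrite inE => /connectP[/= p0 /shortenP[p pathp uniqp _] ->].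
apply/lsumP; exists (size p); last by rewrite (pr _).1; apply: rpow_path.
have : uniq (map val (u :: p)) by rewrite map_inj_uniq //; apply: val_inj.
move/uniq_leq_size => /(_ [seq x.1 | x <- g.1]); rewrite !size_map; apply.
by move=> _ /mapP[w _ ->]; rewrite -(lrep_nodes gG); apply: valP.
Qed.

Lemma prep_PIter r S n m : prep r S ->
  prep (lsum r (lpow g r n) (m.+1 - n)) (\bigcup_(n <= k < m.+1) rpow S k).
Proof.
move=> rS; have pr k : prep (iter k (lcomp r) (lid g)) (rpow S k).
  exact: prep_iter rS prep_lid.
have mem_cup p : reflect (exists2 i, i < m.+1 - n & p \in rpow S (i + n))
    (p \in \bigcup_(n <= k < m.+1) rpow S k).
  rewrite -[n in \bigcup_(n <= k < _) _]add0n big_addn big_mkord.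
  apply: (iffP bigcupP) => [[i _ pi]|[i lti pi]]; first by exists i.
  by exists (Ordinal lti).
apply: prepI => [x y /lsumP[i lti]|u v /mem_cup[i lti uv]].
  rewrite /lpow -iterD => /(prep_ex (pr _))[u [v [-> -> uv]]].
  by exists u, v; split=> //; apply/mem_cup; exists i.
by apply/lsumP; exists i => //; rewrite /lpow -iterD (pr _).1.
Qed.

Lemma prep_ldom r S : prep r S ->
  prep (ldom r) (rdiag [set v | [exists w, (v, w) \in S]]).
Proof.
move=> rS; apply: prep_nodes => [x y /ldomP[<- [z /(prep_ex rS)]]|u].
  by move=> [u [v [-> _ uv]]]; exists u; rewrite inE; split=> //; apply/existsP;
    exists v.
rewrite inE => /existsP[v uv]; apply/ldomP; split=> //.
by exists (val v); rewrite rS.1.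
Qed.

Lemma same_dataE (u w : nodes G) : same_data g (val u) (val w) = (data G u == data G w).
Proof.
apply/hasP/eqP => [[[x c] /lrep_mem_node[v /= -> ->]]|eq_d].
  by move=> /andP[/eqP/val_inj->]; rewrite (lrep_data gG) => /eqP.
exists (val u, data G u); first exact: lrep_mem_data.
by rewrite /= eqxx eq_d lrep_mem_data.
Qed.

(** Serves both data comparisons: [P] is [same_data] or its negation. *)
Lemma prep_join (P : N -> N -> bool) (Q : rel (nodes G)) r1 r2 S1 S2 :
  (forall u w : nodes G, P (val u) (val w) = Q u w) -> prep r1 S1 -> prep r2 S2 ->
  prep (ldom [seq p <- r1 | has (fun q => (q.1 == p.1) && P p.2 q.2) r2])
    (rdiag [set v | [exists u, exists w, [&& (v, u) \in S1, (v, w) \in S2 & Q u w]]]).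
Proof.
move=> PQ p1 p2; apply: prep_nodes => [x y /ldomP[<- [z]]|v].
  rewrite mem_filter => /andP[/hasP[[x' z'] /(prep_ex p2)[v [w [-> -> vw]]]]].
  move=> /andP[/= /eqP<- Pzw] /(prep_ex p1)[v' [u [/val_inj? zu vu]]]; subst v' z.
  exists v; split=> //; rewrite inE; apply/existsP; exists u; apply/existsP; exists w.
  by rewrite vu vw -PQ.
rewrite inE => /existsP[u /existsP[w /and3P[vu vw Quw]]]; apply/ldomP; split=> //.
exists (val u); rewrite mem_filter p1.1 vu andbT; apply/hasP.
by exists (val v, val w); rewrite ?p2.1 //= eqxx PQ.
Qed.

Lemma has_tagE k b j t : has_tag k (b, tagged_tree j t) = (j == k).
Proof. by rewrite /has_tag (inj_eq (can_inj enc_natK)). Qed.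

(* Otherwise conversion runs the tree comparison on the tags. *)
#[local] Opaque has_tag.
#[local] Arguments tagged_tree : simpl never.

Let evals (e : gx_expr Se Sn) S := exists2 r, valued g (code_of e) r & prep r S.

Lemma evals_leval e S : evals e S -> prep (leval g (code_of e)) S.
Proof. by case=> r /leval_valued->. Qed.

Lemma evals0 e S r : kids (code_of e) = [::] ->
  (forall a b, lop g (code_of e) a b = r) -> prep r S -> evals e S.
Proof. by move=> ke opE rS; exists r => //; apply: valued0. Qed.

Lemma evals1 e e0 S S0 f : kids (code_of e) = [:: code_of e0] -> evals e0 S0 ->
  (forall a b, lop g (code_of e) a b = f a) -> (forall a, prep a S0 -> prep (f a) S) ->
  evals e S.
Proof.
by move=> ke [r0 v0 p0] opE fS; exists (f r0); [apply: valued1 ke v0 _|apply: fS].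
Qed.

Lemma evals2 e e0 e1 S S0 S1 f : kids (code_of e) = [:: code_of e0; code_of e1] ->
  evals e0 S0 -> evals e1 S1 ->
  (forall a b, lop g (code_of e) a b = f a b) ->
  (forall a b, prep a S0 -> prep b S1 -> prep (f a b) S) -> evals e S.
Proof.
move=> ke [r0 v0 p0] [r1 v1 p1] opE fS; exists (f r0 r1); last exact: fS.
exact: valued2 ke v0 v1 _.
Qed.

Ltac solve_op := by move=> *; rewrite /kids /lop /lnode_op /lpath_op /= ?has_tagE.

Lemma evals_sem :
  (forall phi, evals (inl phi) (rdiag (node_sem G phi))) /\
  (forall alpha, evals (inr alpha) (path_sem G alpha)).
Proof.
apply: (@gx_expr_mut _ _ (fun phi => evals (inl phi) (rdiag (node_sem G phi)))
  (fun alpha => evals (inr alpha) (path_sem G alpha))).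
- move=> c; apply: (@evals0 _ _
    [seq (y.1, y.1) | y <- [seq y <- g.1 | enc y.2 == enc_count c]]); try solve_op.
  apply: prep_nodes => [x y /mapP[z]|u].
    rewrite mem_filter => /andP[/eqP/EncInj_countType zc].
    by move=> /lrep_mem_node[v zv dv] [-> ->]; exists v; rewrite inE -dv zc eqxx.
  rewrite inE => /eqP<-; apply/mapP; exists (val u, data G u) => //.
  by rewrite mem_filter eqxx lrep_mem_data.
- move=> c; apply: (@evals0 _ _
    [seq (y.1, y.1) | y <- [seq y <- g.1 | enc y.2 != enc_count c]]); try solve_op.
  apply: prep_nodes => [x y /mapP[z]|u].
    rewrite mem_filter => /andP[zc].
    move=> /lrep_mem_node[v zv dv] [-> ->]; exists v; rewrite inE -dv; split=> //.
    by apply: contra zc => /eqP->.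
  rewrite inE => uc; apply/mapP; exists (val u, data G u) => //.
  by rewrite mem_filter lrep_mem_data andbT;
    apply: contra uc => /eqP/EncInj_countType/= ->.
- move=> phi IH1 psi IH2.
  apply: (evals2 (f := fun a b => a ++ b) _ IH1 IH2); try solve_op.
  have -> : rdiag (node_sem G (NOr phi psi)) =
      rdiag (node_sem G phi) :|: rdiag (node_sem G psi).
    by apply/setP => p; rewrite !inE andb_orl.
  by move=> a b; apply: prep_cat.
- move=> phi IH1 psi IH2.
  apply: (evals2 (f := @linter N) _ IH1 IH2); try solve_op.
  have -> : rdiag (node_sem G (NAnd phi psi)) =
      rdiag (node_sem G phi) :&: rdiag (node_sem G psi).
    by apply/setP => p; rewrite !inE; case: eqP; rewrite ?andbT ?andbF.
  by move=> a b; apply: prep_inter.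
- move=> alpha IH; apply: (evals1 (f := @ldom N) _ IH); try solve_op.
  by move=> a; apply: prep_ldom.
- move=> alpha IH1 beta IH2; 
  apply: (evals2 (f := fun a b => ldom [seq p <- a
    | has (fun q => (q.1 == p.1) && same_data g p.2 q.2) b]) _ IH1 IH2); try solve_op.
  by move=> a b; apply: prep_join same_dataE.
- move=> alpha IH1 beta IH2; 
  apply: (evals2 (f := fun a b => ldom [seq p <- a
    | has (fun q => (q.1 == p.1) && ~~ same_data g p.2 q.2) b]) _ IH1 IH2);
      try solve_op.
  move=> a b; apply: (prep_join (P := fun u w => ~~ same_data g u w)) => u w.
  by rewrite same_dataE.
- by apply: (@evals0 _ _ (lid g)); try solve_op; apply: prep_lid.
- apply: (@evals0 _ _ [seq (e.1.1, e.2) | e <- g.2]); try solve_op.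
  apply: prepI => [x y /mapP[e /lrep_mem_edge[u [v [-> -> uv]]] [-> ->]]|u v].
    by exists u, v; split=> //; rewrite inE; apply/set0Pn; exists e.1.2.
  rewrite inE => /set0Pn[a ua]; apply/mapP; exists (val u, a, val v) => //.
  by rewrite (lrep_labels gG).
- move=> a; apply: (@evals0 _ _
    [seq (e.1.1, e.2) | e <- [seq e <- g.2 | enc e.1.2 == enc_count a]]); try solve_op.
  apply: prepI => [x y /mapP[e]|u v].
    rewrite mem_filter => /andP[/eqP/EncInj_countType ea].
    move=> /lrep_mem_edge[u [v [-> -> uv]]] [-> ->].
    by exists u, v; rewrite inE -ea.
  rewrite inE => ua; apply/mapP; exists (val u, a, val v) => //.
  by rewrite mem_filter (lrep_labels gG) ua eqxx.
- move=> a; apply: (@evals0 _ _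
    [seq (e.2, e.1.1) | e <- [seq e <- g.2 | enc e.1.2 == enc_count a]]); try solve_op.
  apply: prepI => [x y /mapP[e]|u v].
    rewrite mem_filter => /andP[/eqP/EncInj_countType ea].
    move=> /lrep_mem_edge[u [v [-> -> uv]]] [-> ->].
    by exists v, u; rewrite inE -ea.
  rewrite inE => ua; apply/mapP; exists (val v, a, val u) => //.
  by rewrite mem_filter (lrep_labels gG) ua eqxx.
- move=> alpha IH1 beta IH2.
  by apply: (evals2 (f := @lcomp N) _ IH1 IH2); try solve_op; move=> a b;
    apply: prep_lcomp.
- move=> alpha IH1 beta IH2.
  by apply: (evals2 (f := fun a b => a ++ b) _ IH1 IH2); try solve_op; move=> a b;
    apply: prep_cat.
- move=> alpha IH1 beta IH2.
  by apply: (evals2 (f := @linter N) _ IH1 IH2); try solve_op; move=> a b;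
    apply: prep_inter.
- move=> alpha IH.
  by apply: (evals1 (f := fun a => lsum a (lid g) (size g.1)) _ IH); try solve_op;
    move=> a; apply: prep_star.
(* A set of nodes is already kept as its diagonal, so the operator of a test is the identity. *)
- by move=> phi IH; apply: (evals1 (f := id) _ IH); try solve_op.
- move=> alpha IH n m.
  apply: (evals1 (f := fun a => lsum a (lpow g a n) (m.+1 - n)) _ IH); try solve_op.
    by move=> a b; rewrite /lop /lpath_op /= !has_tagE /payload /= !enc_natK.
  by move=> a; apply: prep_PIter.
Qed.

Lemma lmodelsP (R : seq (gx_expr Se Sn)) :
  reflect (models G R) (lmodels (map (@code_of Se Sn) R) g).
Proof.
have holdsP e : reflect (match e with
      | inl phi => node_sem G phi = [set: nodes G]
      | inr alpha => path_sem G alpha = [set: nodes G * nodes G] end)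
    (lholds g (code_of e)).
  case: evals_sem => evn evp; case: e => [phi|alpha].
    have pr := evals_leval (evn phi).
    apply: (iffP allP) => [hold|full x /lrep_mem_node[v /= -> _]].
      by apply/setP => v; have := hold _ (lrep_mem_data v);
        rewrite /= (prep_nodesE _ pr) inE.
    by rewrite (prep_nodesE _ pr) full inE.
  have pr := evals_leval (evp alpha).
  apply: (iffP allP) => [hold|full x /lrep_mem_node[u /= -> _]].
    apply/setP => -[u v]; have /allP/= hold_u := hold _ (lrep_mem_data u).
    by have := hold_u _ (lrep_mem_data v); rewrite /= pr.1 inE.
  by apply/allP => z /lrep_mem_node[v -> _]; rewrite pr.1 full inE.
elim: R => [|e R IH] /=; first by left; split.
apply: (iffP andP) => [[/holdsP holds_e /IH[mn mp]]|[mn mp]].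
  by split=> x /= [ex|]; [subst e| exact: mn | subst e | exact: mp].
split; last by apply/IH; split=> x xR; [apply: mn|apply: mp]; right.
by apply/holdsP; case: e mn mp => [phi|alpha] mn mp; [apply: mn|apply: mp]; left.
Qed.

End Semantics.

(** * Subgraphs as lists *)

Section Graphs.

Variables (Se : finType) (Sn N : countType).
Implicit Types (g : lgraph Se Sn N) (G : data_graph Se Sn N).

(** A list form of every graph, with the enumerations of [represents]. It occurs in proofs only and
    never in a program, so it need not be computable. *)
Definition canon G : lgraph Se Sn N :=
  ([seq (val x, data G x) | x : nodes G],
   [seq (val p.1.1, p.2, val p.1.2)
     | p : (nodes G * nodes G * Se)%type in [pred p | p.2 \in labels G p.1]]).

Lemma mem_canon_nodes G x c :
  reflect (exists2 v : nodes G, x = val v & c = data G v) ((x, c) \in (canon G).1).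
Proof.
apply: (iffP imageP) => [[v _ [-> ->]]|[v -> ->]]; first by exists v.
by exists v.
Qed.

Lemma mem_canon_edges G x a y :
  reflect (exists u v : nodes G, [/\ x = val u, y = val v & a \in labels G (u, v)])
    ((x, a, y) \in (canon G).2).
Proof.
apply: (iffP imageP) => [[[[u v] b] /= uv [-> -> ->]]|[u [v [-> -> uv]]]].
  by exists u, v.
by exists (u, v, a).
Qed.

Lemma lrep_canon G : lrep (canon G) G.
Proof.
split.
- rewrite /canon /= -map_comp map_inj_uniq ?enum_uniq //; exact: val_inj.
- rewrite map_inj_uniq ?enum_uniq // => -[[u v] a] [[u' v'] a'] /= [].
  by move=> /val_inj-> -> /val_inj->.
- move=> x; apply/idP/mapP => [xG|[[y c] /mem_canon_nodes[v -> _] ->]];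
  last exact: valP.
  exists (x, data G [` xG]%fset) => //; apply/mem_canon_nodes.
  by exists [` xG]%fset.
- move=> v c; apply/mem_canon_nodes/eqP => [[u /val_inj-> ->]//|<-].
  by exists v.
- move=> u v a; apply/mem_canon_edges/idP => [[u' [v' [/val_inj-> /val_inj->]]]//|uv].
  by exists u, v.
- by move=> [[x a] y] /mem_canon_edges[u [v [/= -> -> _]]]; apply/andP; split;
  apply: valP.
Qed.

Lemma lrep_perm g g' G :
  perm_eq g'.1 g.1 -> perm_eq g'.2 g.2 -> lrep g G -> lrep g' G.
Proof.
move=> p1 p2 [u1 u2 mn md ml me]; have m1 := perm_mem p1; have m2 := perm_mem p2.
split.
- by rewrite (perm_uniq (perm_map _ p1)).
- by rewrite (perm_uniq p2).
- by move=> x; rewrite mn (perm_mem (perm_map _ p1)).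
- by move=> v c; rewrite m1 md.
- by move=> u v a; rewrite m2 ml.
- by move=> e; rewrite m2; apply: me.
Qed.

Lemma lsub_nodes g1 g2 : lsub g1 g2 -> {subset g1.1 <= g2.1}.
Proof. by move=> /andP[/allP]. Qed.

Lemma lsub_edges g1 g2 : lsub g1 g2 -> {subset g1.2 <= g2.2}.
Proof. by move=> /andP[_ /allP]. Qed.

Lemma lsub_refl : reflexive (@lsub Se Sn N).
Proof. by move=> g; apply/andP; split; apply/allP. Qed.

Lemma lsub_trans : transitive (@lsub Se Sn N).
Proof.
move=> g2 g1 g3 s12 s23; apply/andP; split; apply/allP => x.
  by move=> /(lsub_nodes s12)/(lsub_nodes s23).
by move=> /(lsub_edges s12)/(lsub_edges s23).
Qed.

Lemma lproper_irr : irreflexive (@lproper Se Sn N).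
Proof. by move=> g; rewrite /lproper lsub_refl. Qed.

Lemma lproper_trans : transitive (@lproper Se Sn N).
Proof.
move=> g2 g1 g3 /andP[s12 n21] /andP[s23 n32].
rewrite /lproper (lsub_trans s12 s23); apply: contra n21 => s31.
exact: lsub_trans s23 s31.
Qed.

Lemma lsubP g1 g2 G1 G2 : lrep g1 G1 -> lrep g2 G2 ->
  reflect (subgraph G1 G2) (lsub g1 g2).
Proof.
move=> r1 r2; apply: (iffP idP) => [s12|[sub H]].
  have sub : (nodes G1 `<=` nodes G2)%fset.
    apply/fsubsetP => x; rewrite (lrep_nodes r1) (lrep_nodes r2).
    move=> /mapP[y /(lsub_nodes s12) yg ->].
    exact: map_f.
  exists sub => u v; split.
    apply/subsetP => a; rewrite -(lrep_labels r1) -(lrep_labels r2).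
    exact: (lsub_edges s12).
  apply/esym/eqP; rewrite -(lrep_data r2); apply: (lsub_nodes s12).
  exact: (lrep_mem_data r1).
apply/andP; split; apply/allP; first move=> [x c].
  move=> /(lrep_mem_node r1)[v /= -> ->]; have [_ ->] := H v v.
  exact: (lrep_mem_data r2 (fincl sub v)).
move=> [[x a] y] /(lrep_mem_edge r1)[u [v [/= -> ->]]]; have [/subsetP sl _] := H u v.
by move=> /sl; rewrite -(lrep_labels r2).
Qed.

(** Reconciles the two notions of strictness: [proper_subgraph] asks that the graphs differ,
    [lproper] that the converse inclusion fails. *)
Lemma subgraph_anti G1 G2 : subgraph G1 G2 -> subgraph G2 G1 -> G1 = G2.
Proof.
case: G1 G2 => [V1 L1 D1] [V2 L2 D2] [/= s12 H12] [/= s21 H21].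
have eqV : V1 = V2 by apply/eqP; rewrite eqEfsubset s12.
subst V2; have fid (s : (V1 `<=` V1)%fset) v : fincl s v = v by apply: val_inj.
congr DataGraph; apply/ffunP.
  move=> -[u v]; apply/eqP; rewrite eqEsubset.
  have [+ _] := H12 u v; have [+ _] := H21 u v.
  by rewrite !fid => -> ->.
by move=> v; have [_] := H12 v v; rewrite fid.
Qed.

Lemma lproperP g1 g2 G1 G2 : lrep g1 G1 -> lrep g2 G2 ->
  reflect (proper_subgraph G1 G2) (lproper g1 g2).
Proof.
move=> r1 r2; apply: (iffP andP) => [[/(lsubP r1 r2) s12 n21]|[s12 neq]].
  split=> // eqG; case/negP: n21; apply/(lsubP r2 r1).
  by rewrite eqG; apply/(lsubP r2 r2); apply: lsub_refl.
split; first exact/(lsubP r1 r2).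
by apply/negP => /(lsubP r2 r1) s21; apply: neq; apply: subgraph_anti.
Qed.

Lemma lrep_uniq_list g G : lrep g G -> uniq g.1.
Proof. by move=> /lrep_uniq_nodes/map_uniq. Qed.

Lemma lrep_perm_nodes g1 g2 G : lrep g1 G -> lrep g2 G -> perm_eq g1.1 g2.1.
Proof.
move=> r1 r2; apply: uniq_perm; [exact: lrep_uniq_list r1|exact: lrep_uniq_list r2|].
move=> [x c]; apply/idP/idP.
  by move=> /(lrep_mem_node r1)[v /= -> ->]; apply: lrep_mem_data r2 _.
by move=> /(lrep_mem_node r2)[v /= -> ->]; apply: lrep_mem_data r1 _.
Qed.

Lemma lrep_perm_edges g1 g2 G : lrep g1 G -> lrep g2 G -> perm_eq g1.2 g2.2.
Proof.
move=> r1 r2; apply: uniq_perm; [exact: lrep_uniq_edges r1|exact: lrep_uniq_edges r2|].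
move=> [[x a] y]; apply/idP/idP.
  by move=> /(lrep_mem_edge r1)[u [v [/= -> -> uv]]]; rewrite (lrep_labels r2).
by move=> /(lrep_mem_edge r2)[u [v [/= -> -> uv]]]; rewrite (lrep_labels r1).
Qed.

Lemma representsP t G : represents t G <-> exists2 g, t = enc g & lrep g G.
Proof.
split=> [[ns [es [pn pe ->]]]|[g -> r]].
  by exists (ns, es) => //; apply: lrep_perm (lrep_canon G).
exists g.1, g.2; split=> //.
  exact: lrep_perm_nodes r (lrep_canon G).
exact: lrep_perm_edges r (lrep_canon G).
Qed.

Lemma filter_sublists (X : eqType) (P : pred X) s : filter P s \in sublists s.
Proof.
elim: s => //= x s IH; rewrite mem_cat; case: (P x); last by rewrite IH.
by rewrite (map_f (cons x) IH) orbT.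
Qed.

Lemma sublists_subseq (X : eqType) (r s : seq X) : r \in sublists s -> subseq r s.
Proof.
elim: s r => [|x s IH] r /=; first by rewrite inE => /eqP->.
rewrite mem_cat => /orP[/IH rs|/mapP[r' /IH r's ->]]; last by rewrite /= eqxx.
exact: subseq_trans rs (subseq_cons _ _).
Qed.

Lemma candidates_complete g G G' : lrep g G -> subgraph G' G ->
  exists2 g', g' \in candidates g & lrep g' G'.
Proof.
move=> r /(lsubP (lrep_canon G') r) sub.
(* [G'] is listed in the order inherited from [g], because the candidates are made of subsequences
   of the lists of [g]. *)
pose ns := [seq x <- g.1 | x \in (canon G').1].
pose es := [seq e <- g.2 | e \in (canon G').2].
have r' : lrep (ns, es) G'.
  apply: lrep_perm (lrep_canon G'); apply: uniq_perm.
  - by rewrite filter_uniq // (lrep_uniq_list r).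
  - exact: lrep_uniq_list (lrep_canon G').
  - move=> x; rewrite mem_filter; case: (boolP (x \in (canon G').1)) => //.
    by move/(lsub_nodes sub).
  - by rewrite filter_uniq // (lrep_uniq_edges r).
  - exact: lrep_uniq_edges (lrep_canon G').
  - move=> x; rewrite mem_filter; case: (boolP (x \in (canon G').2)) => //.
    by move/(lsub_edges sub).
exists (ns, es) => //; apply/flatten_mapP; exists ns; first exact: filter_sublists.
(* Selecting from the inner edges loses nothing: the edges of [G'] have their ends among its
   nodes. *)
apply: map_f; have -> : es = [seq e <- inner_edges ns g | e \in (canon G').2].
  rewrite -filter_predI; apply: eq_in_filter => e eg /=.
  case: (boolP (e \in _)) => // eG'; rewrite -!(lrep_nodes r').
  have := lrep_ends (lrep_canon G') eG'.
  by move=> ->.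
exact: filter_sublists.
Qed.

Lemma candidates_sound g G g' : lrep g G -> g' \in candidates g ->
  exists2 G', lrep g' G' & subgraph G' G.
Proof.
move=> r /flatten_mapP[ns /sublists_subseq ns_g /mapP[es /sublists_subseq es_g ->]].
pose V := [fset x in [seq x.1 | x <- ns]]%fset.
have mV x : (x \in V) = (x \in [seq x.1 | x <- ns]) by rewrite !inE.
have sub : (V `<=` nodes G)%fset.
  apply/fsubsetP => x; rewrite mV (lrep_nodes r).
  by apply: (mem_subseq (map_subseq _ ns_g)).
pose G' := @DataGraph Se Sn N V
  [ffun p => [set a | (val p.1, a, val p.2) \in es]] [ffun v => data G (fincl sub v)].
have uns : uniq [seq x.1 | x <- ns].
  exact: subseq_uniq (map_subseq _ ns_g) (lrep_uniq_nodes r).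
have r' : lrep (ns, es) G'.
  split=> //=.
  - apply: subseq_uniq es_g _; rewrite filter_uniq //; exact: lrep_uniq_edges r.
  - move=> v c; rewrite ffunE -(lrep_data r); apply/idP/idP.
      exact: (mem_subseq ns_g).
    have := valP v; rewrite mV => /mapP[[x d] xns /= vx].
    rewrite (lrep_data r (fincl sub v)) => /eqP <-.
    (* [ns] lists the node with some value [d]; as the pair also occurs in [g], that value is the
       one in [G]. *)
    have /eqP -> : data G (fincl sub v) == d.
      by rewrite -(lrep_data r) /= vx; apply: mem_subseq ns_g _ xns.
    by rewrite vx.
  - by move=> u v a; rewrite ffunE inE.
  - move=> e /(mem_subseq es_g); rewrite mem_filter => /andP[/andP[e1 e2] _].
    by rewrite !mV e1.
exists G' => //; apply/(lsubP r' r); apply/andP; split; apply/allP => x /=.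
  exact: (mem_subseq ns_g).
by move=> /(mem_subseq es_g); rewrite mem_filter => /andP[].
Qed.

Lemma perm_symbols g1 g2 G : lrep g1 G -> lrep g2 G ->
  perm_eq (symbols g1) (symbols g2).
Proof.
move=> r1 r2; apply: perm_cat; apply: perm_map.
  exact: lrep_perm_edges r1 r2.
exact: lrep_perm_nodes r1 r2.
Qed.

(** Both preferences see a graph only through its list of symbols: weights are the case where [F] is
    [w], multiplicities the case of an indicator function. *)
Lemma big_symbols G (F : Se + Sn -> nat) :
  \sum_(x <- symbols (canon G)) F x =
  \sum_(p : nodes G * nodes G) \sum_(a in labels G p) F (inl a) +
  \sum_(v : nodes G) F (inr (data G v)).
Proof.
rewrite big_cat !big_map /=; congr (_ + _).
by rewrite big_enum pair_big_dep; apply: eq_bigl => -[].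
Qed.

Lemma sum_symbols w g G : lrep g G -> sumn (map w (symbols g)) = graph_weight w G.
Proof.
move=> r; rewrite sumnE big_map (perm_big _ (perm_symbols r (lrep_canon G))).
by rewrite big_symbols /graph_weight pair_big; congr (_ + _); apply: eq_bigr => -[].
Qed.

Lemma count_symbols g G x : lrep g G ->
  count (fun y => y == x) (symbols g) = graph_mset G x.
Proof.
move=> r; rewrite (permP (perm_symbols r (lrep_canon G))) -sum1_count big_mkcond.
rewrite big_symbols; case: x => [a|c] /=.
  rewrite [X in _ + X]big1 // addn0 -sum1_card [RHS]big_mkcond /=.
  apply: eq_bigr => p _; rewrite inE -big_mkcondr /=.
  rewrite (eq_bigl (fun b => (b == a) && (a \in labels G p))); last first.
    move=> b; rewrite andbC; case: eqP => [[->]|nab]; first by rewrite eqxx.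
    by case: eqP => // eqb; case: nab; rewrite eqb.
  case: (a \in labels G p); last by rewrite big1 // => b; rewrite andbF.
  by rewrite (eq_bigl (pred1 a)) ?big_pred1_eq // => b; rewrite andbT.
rewrite [X in X + _]big1 ?add0n; last by move=> p _; rewrite big1.
by rewrite -big_mkcond -sum1_card /=; apply: eq_bigl => v; rewrite inE.
Qed.

End Graphs.

(** * Preferences *)

Section MultisetOrder.

Variables (X : eqType) (lt : rel X).

Definition mult (s : seq X) (x : X) : nat := count (fun y => y == x) s.

Lemma mult_mem s x : 0 < mult s x -> x \in s.
Proof. by rewrite -has_count has_pred1. Qed.

(** The test [mset_ltb] over an arbitrary [eqType]; on lists of symbols the two are convertible. *)
Definition mset_ltl (s1 s2 : seq X) : bool :=
  has (fun x => mult s1 x != mult s2 x) (s1 ++ s2) &&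
  all (fun x => (mult s2 x < mult s1 x) ==>
    has (fun z => lt x z && (mult s1 z < mult s2 z)) s2) s1.

Lemma mset_ltlP s1 s2 : reflect (mset_lt lt (mult s1) (mult s2)) (mset_ltl s1 s2).
Proof.
apply: (iffP andP) => [[/hasP[x _ nx] /allP lt12]|[neq lt12]]; split.
- by move=> eq12; rewrite eq12 eqxx in nx.
- move=> y ty; have ys : y \in s1 by apply: mult_mem; apply: leq_ltn_trans ty.
  by have /implyP/(_ ty)/hasP[z _ /andP[]] := lt12 _ ys; exists z.
- apply/negPn/negP => /hasPn eq12; apply: neq => x.
  apply/eqP/negPn/negP => nx; suff /eq12 : x \in s1 ++ s2 by rewrite nx.
  rewrite mem_cat; case: (posnP (mult s1 x)) => [m0|/mult_mem->//].
  by rewrite (@mult_mem s2 x) ?orbT // lt0n -m0 eq_sym.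
- apply/allP => x _; apply/implyP => /lt12[z [xz mz]].
  apply/hasP; exists z; rewrite ?xz //; apply: mult_mem.
  exact: leq_ltn_trans mz.
Qed.

Hypotheses (ltI : irreflexive lt) (ltT : transitive lt).

Lemma mset_ltl_irr : irreflexive mset_ltl.
Proof. by move=> s; apply/mset_ltlP => -[[]]. Qed.

(* At a maximal symbol among those where [s1], [s2], [s3] do not all agree, the
   multiplicities are non-decreasing. *)
Lemma mset_ltl_trans : transitive mset_ltl.
Proof.
move=> s2 s1 s3 /mset_ltlP[n12 lt12] /mset_ltlP[n23 lt23].
pose differ x := (mult s1 x != mult s2 x) || (mult s2 x != mult s3 x).
(* [P] is an upward closed set of symbols. Taking all symbols shows that [s1] and [s3] differ;
   taking those above [x] yields the witness required when [s1] exceeds [s3] at [x]. *)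
have top (P : pred X) : (exists2 x, P x & differ x) ->
    (forall x y, P x -> lt x y -> P y) -> exists2 x, P x & mult s1 x < mult s3 x.
  move=> [x0 Px0 dx0] upP.
  have inS x : differ x -> x \in s1 ++ s2 ++ s3.
    rewrite !mem_cat /differ; case: (posnP (mult s1 x)) => [->|/mult_mem-> //].
    case: (posnP (mult s2 x)) => [->|/mult_mem->]; last by rewrite orbT.
    by rewrite eqxx eq_sym -lt0n => /mult_mem->; rewrite !orbT.
  have nz : [seq x <- s1 ++ s2 ++ s3 | P x && differ x] != [::].
    by rewrite -has_filter; apply/hasP; exists x0; rewrite ?Px0 ?inS.
  have := maximals_nonempty ltI ltT nz.
  case E: maximals => [//|x t] _.
  have : x \in maximals lt [seq x <- s1 ++ s2 ++ s3 | P x && differ x].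
    by rewrite E mem_head.
  rewrite !mem_filter => /andP[/hasPn max_x /andP[/andP[Px dx] _]].
  have maxd y : lt x y -> ~~ differ y.
    move=> xy; apply/negP => dy; move: (max_x y); rewrite mem_filter dy inS //.
    by rewrite (upP _ _ Px xy) xy => /(_ isT).
  exists x => //.
  have le12 : mult s1 x <= mult s2 x.
    rewrite leqNgt; apply/negP => /lt12[y [/maxd/norP[/negPn/eqP-> _]]].
    by rewrite ltnn.
  have le23 : mult s2 x <= mult s3 x.
    rewrite leqNgt; apply/negP => /lt23[y [/maxd/norP[_ /negPn/eqP->]]].
    by rewrite ltnn.
  by move: dx; rewrite /differ; lia.
apply/mset_ltlP; split.
  move=> eq13; have [||x _] := top predT; last by rewrite eq13 ltnn.
    have /hasP[x _ nx] : has (fun x => mult s1 x != mult s2 x) (s1 ++ s2).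
      by case/andP: (introT (mset_ltlP s1 s2) (conj n12 lt12)).
    by exists x => //; rewrite /differ nx.
  by [].
move=> x lt31; have [|y z|y xy ly] := top (lt x).
(* A drop at [x] from [s1] to [s3] is a drop from [s1] to [s2] or from [s2] to [s3], and that step
   supplies a symbol above [x] on which two of the lists differ. *)
- have [/lt12[y [xy ly]]|le12] := ltnP (mult s2 x) (mult s1 x).
    by exists y => //; rewrite /differ (ltn_eqF ly).
  have /lt23[y [xy ly]] : mult s3 x < mult s2 x by apply: leq_trans lt31 le12.
  by exists y => //; rewrite /differ (ltn_eqF ly) orbT.
- exact: ltT.
- by exists y.
Qed.

End MultisetOrder.

(** * Correctness of the search *)

Section Solution.

Variables (Se : finType) (Sn N : countType) (Pref : preference Se Sn).
Hypothesis adm : admissible Pref.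
Implicit Types (g : lgraph Se Sn N) (G : data_graph Se Sn N).

Lemma lpreferred_irr : irreflexive (@lpreferred Se Sn N Pref).
Proof.
case: Pref => [w|lt] g /=; first by rewrite ltnn.
exact: mset_ltl_irr.
Qed.

Lemma lpreferred_trans : transitive (@lpreferred Se Sn N Pref).
Proof.
case: Pref adm => [w _|lt [ltI ltT _ _]] g2 g1 g3 /=; first exact: ltn_trans.
exact: (mset_ltl_trans ltI ltT).
Qed.

Lemma lpreferredP g1 g2 G1 G2 : lrep g1 G1 -> lrep g2 G2 ->
  reflect (preferred_to Pref G1 G2) (lpreferred Pref g1 g2).
Proof.
move=> r1 r2; case: Pref => [w|lt] /=.
  by rewrite (sum_symbols w r1) (sum_symbols w r2); apply: idP.
have m1 x := count_symbols x r1; have m2 x := count_symbols x r2.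
apply: (iffP (mset_ltlP lt _ _)) => -[neq lt12]; split.
- by move=> eq12; apply: neq => x; rewrite /mult m1 m2.
- move=> x; rewrite -m1 -m2 => /lt12[y]; rewrite /mult m1 m2.
  by exists y.
- by move=> eq12; apply: neq => x; rewrite -m1 -m2; apply: eq12.
- move=> x; rewrite /mult m1 m2 => /lt12[y]; rewrite -m1 -m2.
  by exists y.
Qed.

(** Soundness of the candidates turns the answer and its rivals in the list into subgraphs;
    completeness ensures that any larger model or preferred repair among all graphs would have shown
    up in the list. *)
Lemma solve_preferred_repair g G (R : seq (gx_expr Se Sn)) : lrep g G ->
  exists2 G', lrep (solve Pref g (map (@code_of Se Sn) R)) G' &
              preferred_repair Pref R G G'.
Proof.
move=> r; set cR := map _ R.
pose ms := [seq c <- candidates g | lmodels cR c].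
have repairP g' G' : g' \in candidates g -> lrep g' G' -> subgraph G' G ->
    reflect (subset_repair R G G') (g' \in maximals (@lproper Se Sn N) ms).
  move=> cg' r' sub; rewrite !mem_filter cg' andbT.
  apply: (iffP andP) => [[/hasPn max /(lmodelsP r') mod]|[/(lmodelsP r') mod _ max]].
    split=> // -[G'' [mod'' prop'' sub'']].
    have [g'' cg'' r''] := candidates_complete r sub''.
    have /max/negP : g'' \in ms.
      by rewrite mem_filter cg'' andbT; apply/(lmodelsP r'').
    by apply; apply/(lproperP r' r'').
  split=> //; apply/hasPn => g''; rewrite mem_filter => /andP[mod'' cg''].
  have [G'' r'' sub''] := candidates_sound r cg''.
  apply/negP => /(lproperP r' r'') prop''; apply: max; exists G''; split=> //.
  exact/(lmodelsP r'').
have ms0 : ms != [::].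
  rewrite -has_filter; apply/hasP; exists ([::], [::]).
    apply/flatten_mapP; exists [::].
      by have := filter_sublists pred0 g.1; rewrite filter_pred0.
    apply: map_f; have := filter_sublists pred0 (inner_edges [::] g).
    by rewrite filter_pred0.
  exact/allP.
have rs0 := maximals_nonempty (@lproper_irr _ _ _) (@lproper_trans _ _ _) ms0.
have := maximals_nonempty lpreferred_irr lpreferred_trans rs0.
rewrite /solve -/ms; case E: (maximals (lpreferred Pref) _) => [//|g' s] _ /=.
have : g' \in maximals (lpreferred Pref) (maximals (@lproper Se Sn N) ms).
  by rewrite E mem_head.
rewrite mem_filter => /andP[/hasPn best rep'].
have cg' : g' \in candidates g by move: rep'; rewrite !mem_filter => /and3P[].
have [G' r' sub'] := candidates_sound r cg'.
exists G' => //; split; first exact/(repairP g').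
move=> [G'' [rep'' _ pref'']]; have [_ sub'' _] := rep''.
have [g'' cg'' r''] := candidates_complete r sub''.
have /best/negP : g'' \in maximals (@lproper Se Sn N) ms by apply/(repairP g'' G'').
by apply; apply/(lpreferredP r' r'').
Qed.

End Solution.

Theorem theorem2 (Se : finType) (Sn N : countType)
  (Se_nonempty : 0 < #|Se|) (Sn_nonempty : inhabited Sn)
  (Pref : preference Se Sn) (Pref_adm : admissible Pref) :
  exists c : cmd,
    forall (G : data_graph Se Sn N) (R : seq (gx_expr Se Sn)) (t : tree),
      represents t G ->
      exists (G' : data_graph Se Sn N) (t' : tree),
        [/\ outputs c (Pair t (enc_constraints R)) t',
            represents t' G' &
            preferred_repair Pref R G G'].
Proof.
have [c out_c] : computable (fun p : lgraph Se Sn N * seq code => solve Pref p.1 p.2).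
  by apply: computable_solve => //; ctac.
exists c => G R t /representsP[g -> r].
have [G' r' pref'] := solve_preferred_repair Pref_adm R r.
exists G', (enc (solve Pref g (map (@code_of Se Sn) R))); split=> //.
  (* The encoding of a sum is that of a pair of a boolean and a tree, so the input is already a list
     of codes and needs no conversion. *)
  have -> : enc_constraints R = enc (map (@code_of Se Sn) R).
    by elim: R {r' pref'} => // -[e|e] R IH; congr (Pair _ _); apply: IH.
  exact: (out_c (g, _) I).
by apply/representsP; exists (solve Pref g (map (@code_of Se Sn) R)).
Qed.
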